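(* If $d>0$, $\upsilon>0$, $c,l,t\in\mathbb{C}$ and $l>-\frac{3}{2}$, then the equation $$N(t)-N_{0}\,\mathtt{S}_{l,c}^{\mathtt{k}}\left(d^{\upsilon}t^{\upsilon}\right)=-d^{\upsilon}\;{}_{0}D_{t}^{-\upsilon}N(t)$$ has the following solution: $$N(t)=N_{0}\sum_{r=0}^{\infty}\frac{(-c)^{r}\,\Gamma\left(2r\upsilon+\upsilon l+\upsilon+1\right)}{\Gamma_{\mathtt{k}}\left(r\mathtt{k}+l+\frac{3}{2}\mathtt{k}\right)\Gamma\left(r+\frac{3}{2}\right)}\left(\frac{d^{\upsilon}}{2}\right)^{2r+l+1}t^{2\upsilon r+l\upsilon+\upsilon}\,E_{\upsilon,\,2r\upsilon+l\upsilon+\upsilon+1}\left(-d^{\upsilon}t^{\upsilon}\right),$$ where $E_{\upsilon,\,2r\upsilon+l\upsilon+\upsilon+1}(\cdot)$ is the generalized Mittag-Leffler function.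
   Context: $N_0$ is a constant and $N(t)$ is the unknown function. $\Gamma_{\mathtt{k}}$ is the $\mathtt{k}$-gamma function ($\mathtt{k}>0$), $\Gamma_{\mathtt{k}}(x)=\mathtt{k}^{\frac{x}{\mathtt{k}}-1}\Gamma(x/\mathtt{k})$. The $\mathtt{k}$-Struve function is $$\mathtt{S}_{\nu,c}^{\mathtt{k}}(x)=\sum_{r=0}^{\infty}\frac{(-c)^r}{\Gamma_{\mathtt{k}}\left(r\mathtt{k}+\nu+\frac{3\mathtt{k}}{2}\right)\Gamma\left(r+\frac{3}{2}\right)}\left(\frac{x}{2}\right)^{2r+\frac{\nu}{\mathtt{k}}+1}.$$ The Riemann-Liouville fractional integral is ${}_{0}D_{t}^{-\upsilon}f(t)=\frac{1}{\Gamma(\upsilon)}\int_{0}^{t}(t-s)^{\upsilon-1}f(s)\,ds$, $\mathcal{R}(\upsilon)>0$. The generalized Mittag-Leffler function is $E_{\alpha,\beta}(x)=\sum_{n=0}^{\infty}\frac{x^{n}}{\Gamma(\alpha n+\beta)}$.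
   Formalization: In the solution, l is replaced by l/k in the exponents, the Gamma argument and the Mittag-Leffler index (same for k=1); υ(Re l/k+1) > -1 is added so the fractional integral converges; l > -3/2 is read as Re l > -3/2, and d^υ t^υ is taken with argument υ arg t. *)

(* Defs.v *)
(* MathComp-Analysis over an abstract R : realType; complex numbers are R[i]. *)
From HB Require Import structures.
From mathcomp Require Import all_boot all_order all_algebra.
From mathcomp Require Import all_classical all_reals all_analysis.
From mathcomp Require Import complex.

Set Implicit Arguments.
Unset Strict Implicit.
Unset Printing Implicit Defensive.

Import Order.TTheory GRing.Theory Num.Theory numFieldNormedType.Exports.

Local Open Scope classical_set_scope.
Local Open Scope ring_scope.
Local Open Scope complex_scope.

Section ComplexAnalysis.
Context {R : realType}.
Implicit Types (z x t a : R[i]) (u : nat -> R[i]).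

(* Series and Lebesgue integrals of complex-valued functions are taken
   componentwise; the predicates cvg_csum and cintegrable say that the values
   csum and cintegral are meaningful. *)
Definition cvg_csum u : Prop :=
  cvgn (series (fun n => complex.Re (u n))) /\
  cvgn (series (fun n => complex.Im (u n))).

Definition csum u : R[i] :=
  limn (series (fun n => complex.Re (u n))) +i*
  limn (series (fun n => complex.Im (u n))).

Definition cintegrable (D : set R) (f : R -> R[i]) : Prop :=
  (@lebesgue_measure R).-integrable D (EFin \o (fun y : R => complex.Re (f y))) /\
  (@lebesgue_measure R).-integrable D (EFin \o (fun y : R => complex.Im (f y))).

Definition cintegral (D : set R) (f : R -> R[i]) : R[i] :=
  Rintegral (@lebesgue_measure R) D (fun y : R => complex.Re (f y)) +i*
  Rintegral (@lebesgue_measure R) D (fun y : R => complex.Im (f y)).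

Definition cexp z : R[i] :=
  (expR (complex.Re z))%:C * (cos (complex.Im z) +i* sin (complex.Im z)).

Definition cabs z : R := complex.Re `|z|.

(* Principal argument, with values in ]-pi, pi] for z != 0. *)
Definition carg z : R :=
  if 0 <= complex.Im z then acos (complex.Re z / cabs z)
  else - acos (complex.Re z / cabs z).

(* The power x ^ a computed with the determination ln |x| + i theta of log x,
   where theta is an argument of x.  By convention 0 ^ a is 1 if a = 0 and 0
   otherwise. *)
Definition cpow_arg x (theta : R) a : R[i] :=
  if x == 0 then (a == 0)%:R else cexp (a * (ln (cabs x) +i* theta)).

Definition cpow x a : R[i] := cpow_arg x (carg x) a.

End ComplexAnalysis.

Section SpecialFunctions.
Context {R : realType}.
Implicit Types (z x t a b c nu v : R[i]).

Definition Gamma_integral z : R[i] :=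
  cintegral `]0, +oo[ (fun x : R => cpow x%:C (z - 1) * (expR (- x))%:C).

(* Euler's integral for Re z > 0, extended to the left by the functional
   equation Gamma (z + 1) = z * Gamma z.  At the poles 0, -1, -2, ... the
   denominator vanishes and the value is 0, so that the reciprocal is 0 too,
   which is the value there of the entire function 1 / Gamma. *)
Definition Gamma z : R[i] :=
  let n := if 0 < complex.Re z then 0%N else Num.bound (complex.Re z) in
  Gamma_integral (z + n%:R) / \prod_(i < n) (z + i%:R).

Definition kGamma (k : R) z : R[i] :=
  cpow k%:C (z / k%:C - 1) * Gamma (z / k%:C).

Definition mittag_leffler_term a b x (n : nat) : R[i] :=
  x ^+ n / Gamma (a * n%:R + b).

Definition mittag_leffler a b x : R[i] := csum (mittag_leffler_term a b x).

(* (-c)^r / (Gamma_k (r k + nu + 3k/2) * Gamma (r + 3/2)) *)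
Definition kstruve_coef (k : R) nu c (r : nat) : R[i] :=
  (- c) ^+ r /
  (kGamma k (r%:R * k%:C + nu + 3 * k%:C / 2) * Gamma (r%:R + 3 / 2)).

(* The k-Struve function is multivalued in x; theta is the argument of x that
   fixes the determination of (x / 2) ^ (2r + nu/k + 1). *)
Definition kstruve_term (k : R) nu c x (theta : R) (r : nat) : R[i] :=
  kstruve_coef k nu c r * cpow_arg (x / 2) theta (2 * r%:R + nu / k%:C + 1).

Definition kstruve (k : R) nu c x (theta : R) : R[i] :=
  csum (kstruve_term k nu c x theta).

(* The integral of (t - s)^(v - 1) f(s) ds along the segment from 0 to t,
   parametrized by s = y t with 0 < y < 1. *)
Definition riemann_liouville_integrand v (f : R[i] -> R[i]) t (y : R) : R[i] :=
  cpow (t - y%:C * t) (v - 1) * f (y%:C * t) * t.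

Definition riemann_liouville v (f : R[i] -> R[i]) t : R[i] :=
  (Gamma v)^-1 * cintegral `]0, 1[ (riemann_liouville_integrand v f t).

End SpecialFunctions.

Section KineticEquation.
Context {R : realType}.
Implicit Types (k d v : R) (l c t : R[i]).

(* N solves N(t) - N0 S(d^v t^v) = - d^v D^(-v) N(t) for every complex t.  The
   argument of d^v t^v is taken to be v arg t, so that the powers satisfy
   (d^v t^v) ^ a = d ^ (v a) * t ^ (v a); this is the principal argument as soon
   as - pi < v arg t <= pi, in particular for t > 0. *)
Definition kinetic_solution k d v (N0 : R[i]) l c (N : R[i] -> R[i]) : Prop :=
  forall t,
    let x := (d `^ v)%:C * cpow t v%:C in
    [/\ cvg_csum (kstruve_term k l c x (v * carg t)),
        cintegrable `]0, 1[ (riemann_liouville_integrand v%:C N t)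
      & N t - N0 * kstruve k l c x (v * carg t)
        = - ((d `^ v)%:C * riemann_liouville v%:C N t)].

(* 2 r v + v l/k + v + 1 *)
Definition solution_index k v l (r : nat) : R[i] :=
  2 * r%:R * v%:C + v%:C * (l / k%:C) + v%:C + 1.

Definition solution_term k d v l c t (r : nat) : R[i] :=
  kstruve_coef k l c r * Gamma (solution_index k v l r)
  * cpow ((d `^ v)%:C / 2) (2 * r%:R + l / k%:C + 1)
  * cpow t (2 * v%:C * r%:R + l / k%:C * v%:C + v%:C)
  * mittag_leffler v%:C (solution_index k v l r)
      (- ((d `^ v)%:C * cpow t v%:C)).

End KineticEquation.

(* Main.v *)
Require Import Defs.
From HB Require Import structures.
From mathcomp Require Import all_boot all_order all_algebra.
From mathcomp Require Import all_classical all_reals all_analysis.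
From mathcomp Require Import measurable_realfun.
From mathcomp Require Import complex ring lra.

Set Implicit Arguments.
Unset Strict Implicit.
Unset Printing Implicit Defensive.

Import Order.TTheory GRing.Theory Num.Theory numFieldNormedType.Exports.

Local Open Scope classical_set_scope.
Local Open Scope ring_scope.
Local Open Scope complex_scope.

(* With a_r = 2 r + l / k + 1, b_r = v a_r + 1 and X(t) = - (d t)^v, the r-th term
   of the proposed solution is S_r(t) * sum_n Gamma(b_r) X(t)^n / Gamma(v n + b_r),
   where S_r is the r-th term of the k-Struve series.  Integrating term by term,
   the Beta identity Gamma(p) Gamma(q) = Gamma(p + q) B(p, q) shows that
   - d^v times the fractional integral shifts n to n + 1, so only the terms
   n = 0, whose sum is the k-Struve series, are missing.

   The majorants that justify the two exchanges come from the same identity: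
   |Gamma(b) / Gamma(b + s)| = |B(b, s)| / Gamma(s), and B is monotone in the real
   parts of its arguments.  So does Gamma(z) != 0 for Re z > 0: a zero z gives a
   zero z / 2 (take p = q = z / 2), hence zeros z / 2^m and then z / 2^m + 1 for
   all m, contradicting the continuity of Gamma at 1. *)


(** Scaling [t] by a real y > 0 leaves its argument unchanged, so [(t - y t)^(v-1)] and the powers
    of [y t] split into a power of [t] and a power of the positive real y or 1 - y. This turns the
    integral along the complex segment into Beta integrals over ]0, 1[ with complex parameters. For
    these the Beta identity rests on the substitution x = s u, y = s (1 - u) in a double integral,
    carried out by one-dimensional affine changes and Tonelli; it yields the integrability of the
    Beta integrand as well. The hypothesis [hint] says Re b_0 > 0: the leading power t^(b_0 - 1) of
    the solution is integrable at 0. Since Re b_r >= Re b_0, one Beta integrand dominates those of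
    all r and n. Both exchanges, over n for fixed r and then over r, thus use the same integrable
    function of y, and the series in r inherits its convergence from the k-Struve series. There the
    integral vanishes, and the solution agrees with the k-Struve series term by term. *)

Section Modulus.
Context {R : realType}.
Implicit Types (z w : R[i]) (x : R).

Lemma complex_ext z w :
  complex.Re z = complex.Re w -> complex.Im z = complex.Im w -> z = w.
Proof. by case: z => a b; case: w => c d /= -> ->. Qed.

Lemma Re_add z w : complex.Re (z + w) = complex.Re z + complex.Re w.
Proof. by case: z; case: w. Qed.

Lemma Im_add z w : complex.Im (z + w) = complex.Im z + complex.Im w.
Proof. by case: z; case: w. Qed.

Lemma Re_opp z : complex.Re (- z) = - complex.Re z.
Proof. by case: z. Qed.

Lemma Im_opp z : complex.Im (- z) = - complex.Im z.
Proof. by case: z. Qed.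

Lemma Re_mul z w : complex.Re (z * w) =
  complex.Re z * complex.Re w - complex.Im z * complex.Im w.
Proof. by case: z; case: w. Qed.

Lemma Im_mul z w : complex.Im (z * w) =
  complex.Re z * complex.Im w + complex.Im z * complex.Re w.
Proof. by case: z; case: w. Qed.

Lemma Re_mulR z x : complex.Re (z * x%:C) = complex.Re z * x.
Proof. by rewrite Re_mul /= mulr0 subr0. Qed.

Lemma Im_mulR z x : complex.Im (z * x%:C) = complex.Im z * x.
Proof. by rewrite Im_mul /= mulr0 add0r. Qed.

Lemma natC n : n%:R = (n%:R : R)%:C :> R[i].
Proof. by rewrite rmorph_nat. Qed.

Lemma norm_cabs z : `|z| = (cabs z)%:C.
Proof. by rewrite /cabs; case: z => a b; rewrite normc_def. Qed.

Lemma cabs_sqrt z : cabs z = Num.sqrt (complex.Re z ^+ 2 + complex.Im z ^+ 2).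
Proof. by rewrite /cabs; case: z => a b; rewrite normc_def. Qed.

Lemma real_complex_eq0 x : (x%:C == 0 :> R[i]) = (x == 0).
Proof. by rewrite eq_complex /= eqxx andbT. Qed.

Lemma cabs_ge0 z : 0 <= cabs z.
Proof. by rewrite cabs_sqrt sqrtr_ge0. Qed.

Lemma cabsM z w : cabs (z * w) = cabs z * cabs w.
Proof. by apply: complexI; rewrite rmorphM -!norm_cabs normrM. Qed.

Lemma cabsV z : cabs z^-1 = (cabs z)^-1.
Proof. by apply: complexI; rewrite fmorphV -!norm_cabs normfV. Qed.

Lemma cabsX z n : cabs (z ^+ n) = cabs z ^+ n.
Proof. by apply: complexI; rewrite rmorphXn -!norm_cabs normrX. Qed.

Lemma cabsR x : cabs x%:C = `|x|.
Proof. by rewrite cabs_sqrt /= expr0n /= addr0 sqrtr_sqr. Qed.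

Lemma cabs0 : cabs (0 : R[i]) = 0.
Proof. by rewrite (cabsR 0) normr0. Qed.

Lemma cabs_eq0 z : (cabs z == 0) = (z == 0).
Proof.
by rewrite -(normr_eq0 z) norm_cabs real_complex_eq0.
Qed.

Lemma cabs_gt0 z : (0 < cabs z) = (z != 0).
Proof. by rewrite lt_def cabs_eq0 cabs_ge0 andbT. Qed.

Lemma Re_le_cabs z : `|complex.Re z| <= cabs z.
Proof.
by rewrite cabs_sqrt -sqrtr_sqr ler_wsqrtr// lerDl sqr_ge0.
Qed.

Lemma Im_le_cabs z : `|complex.Im z| <= cabs z.
Proof.
by rewrite cabs_sqrt -sqrtr_sqr ler_wsqrtr// lerDr sqr_ge0.
Qed.

Lemma cabs_le z : cabs z <= `|complex.Re z| + `|complex.Im z|.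
Proof.
rewrite cabs_sqrt -[leRHS]ger0_norm ?addr_ge0// -sqrtr_sqr ler_wsqrtr//.
rewrite sqrrD !real_normK ?num_real// lerD2r lerDl.
by rewrite mulrn_wge0// mulr_ge0.
Qed.

End Modulus.

(** * Complex exponential and complex powers *)

Section Powers.
Context {R : realType}.
Implicit Types (z w a b t : R[i]) (x y th : R).

Lemma cexpD a b : cexp (a + b) = cexp a * cexp b.
Proof.
rewrite /cexp Re_add Im_add expRD rmorphM /= cosD sinD.
have -> : (cos (complex.Im a) * cos (complex.Im b) -
    sin (complex.Im a) * sin (complex.Im b)) +i*
    (sin (complex.Im a) * cos (complex.Im b) +
     cos (complex.Im a) * sin (complex.Im b)) =
  (cos (complex.Im a) +i* sin (complex.Im a)) *
  (cos (complex.Im b) +i* sin (complex.Im b)) :> R[i].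
  by apply/eqP; rewrite eq_complex /= eqxx /= addrC.
by rewrite mulrACA.
Qed.

Lemma Re_cexp a : complex.Re (cexp a) = expR (complex.Re a) * cos (complex.Im a).
Proof. by rewrite /cexp Re_mul /= mul0r subr0. Qed.

Lemma cexp0 : cexp (0 : R[i]) = 1.
Proof. by rewrite /cexp /= expR0 cos0 sin0 mul1r. Qed.

Lemma cabs_cexp a : cabs (cexp a) = expR (complex.Re a).
Proof.
rewrite /cexp cabsM cabsR ger0_norm ?expR_ge0//.
by rewrite cabs_sqrt /= cos2Dsin2 sqrtr1 mulr1.
Qed.

Lemma cexp_neq0 a : cexp a != 0.
Proof. by rewrite -cabs_gt0 cabs_cexp expR_gt0. Qed.

Lemma carg_pos x : 0 < x -> carg x%:C = 0.
Proof.
by move=> x0; rewrite /carg /= lexx cabsR gtr0_norm// divff ?gt_eqF// acos1.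
Qed.

Lemma carg_scale x t : 0 < x -> carg (x%:C * t) = carg t.
Proof.
move=> x0; rewrite /carg Re_mul Im_mul /= !mul0r subr0 addr0 cabsM cabsR gtr0_norm//.
by rewrite pmulr_rge0// -mulf_div divff ?gt_eqF// mul1r.
Qed.

(* rpow x is cpow x%:C for x > 0, but is measurable in x on the whole line. *)
Definition rpow x a : R[i] := cexp (a * (ln x)%:C).

Lemma rpowE x a : 0 < x -> cpow x%:C a = rpow x a.
Proof.
move=> x0; rewrite /cpow /cpow_arg carg_pos// cabsR gtr0_norm// ifN//.
by rewrite real_complex_eq0 gt_eqF.
Qed.

Lemma rpowD x a b : rpow x (a + b) = rpow x a * rpow x b.
Proof. by rewrite /rpow mulrDl cexpD. Qed.

Lemma rpowM x y a : 0 < x -> 0 < y -> rpow (x * y) a = rpow x a * rpow y a.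
Proof. by move=> x0 y0; rewrite /rpow lnM ?posrE// rmorphD mulrDr cexpD. Qed.

Lemma cabs_rpow x a : 0 < x -> cabs (rpow x a) = x `^ complex.Re a.
Proof.
by move=> x0; rewrite /rpow cabs_cexp Re_mul /= mulr0 subr0 /powR gt_eqF.
Qed.

Lemma rpow_real x y : 0 < x -> rpow x y%:C = (x `^ y)%:C.
Proof.
move=> x0; rewrite /rpow -rmorphM /cexp /= cos0 sin0 mulr1 /powR gt_eqF//.
Qed.

Lemma rpow0 x : rpow x 0 = 1.
Proof. by rewrite /rpow mul0r cexp0. Qed.

Lemma rpow1 x : 0 < x -> rpow x 1 = x%:C.
Proof. by move=> x0; rewrite (rpow_real 1)// powRr1// ltW. Qed.

Lemma cpow_arg_neq0 t th a : t != 0 ->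
  cpow_arg t th a = cexp (a * (ln (cabs t) +i* th)).
Proof. by rewrite /cpow_arg => /negbTE ->. Qed.

Lemma cpowD t a b : t != 0 -> cpow t (a + b) = cpow t a * cpow t b.
Proof. by move=> t0; rewrite /cpow !cpow_arg_neq0// mulrDl cexpD. Qed.

Lemma cpow_neq0 t a : t != 0 -> cpow t a != 0.
Proof. by move=> t0; rewrite /cpow cpow_arg_neq0// cexp_neq0. Qed.

(** Principal powers are not multiplicative in general; a positive factor does not move the
    argument, so here no branch correction arises. *)
Lemma cpow_scale x t a : 0 < x -> t != 0 ->
  cpow (x%:C * t) a = rpow x a * cpow t a.
Proof.
move=> x0 t0; have xt0 : x%:C * t != 0.
  by rewrite mulf_neq0// real_complex_eq0 gt_eqF.
rewrite /cpow carg_scale// !cpow_arg_neq0// -cexpD -mulrDr.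
congr (cexp (_ * _)); rewrite cabsM cabsR gtr0_norm// lnM ?posrE ?cabs_gt0//.
by apply/eqP; rewrite eq_complex /= add0r !eqxx.
Qed.

Lemma cos_carg t : t != 0 -> cos (carg t) = complex.Re t / cabs t.
Proof.
rewrite -cabs_gt0 => t0.
have h : -1 <= complex.Re t / cabs t <= 1.
  by rewrite -ler_norml normrM normfV (gtr0_norm t0) ler_pdivrMr// mul1r Re_le_cabs.
by rewrite /carg; case: ifP => _; rewrite ?cosN acosK// in_itv.
Qed.

Lemma sin_carg t : t != 0 -> sin (carg t) = complex.Im t / cabs t.
Proof.
rewrite -cabs_gt0 => t0.
have h : -1 <= complex.Re t / cabs t <= 1.
  by rewrite -ler_norml normrM normfV (gtr0_norm t0) ler_pdivrMr// mul1r Re_le_cabs.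
have s : sin (acos (complex.Re t / cabs t)) = `|complex.Im t| / cabs t.
  rewrite sin_acos//.
  have -> : 1 - (complex.Re t / cabs t) ^+ 2 = (complex.Im t / cabs t) ^+ 2.
    have e : cabs t ^+ 2 = complex.Re t ^+ 2 + complex.Im t ^+ 2.
      by rewrite cabs_sqrt sqr_sqrtr// addr_ge0// sqr_ge0.
    rewrite !expr_div_n e.
    rewrite -[X in X - _](@divff _ (complex.Re t ^+ 2 + complex.Im t ^+ 2)).
      by rewrite -mulrBl addrC addKr.
    by rewrite -e expf_eq0 /= gt_eqF.
  by rewrite sqrtr_sqr normrM normfV (gtr0_norm t0).
rewrite /carg; case: ifPn => [Im0|]; first by rewrite s ger0_norm.
by rewrite -ltNge sinN s => Im0; rewrite ltr0_norm// mulNr opprK.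
Qed.

(** [cos_carg] and [sin_carg] make [ln (cabs t) +i* carg t] a genuine logarithm of [t]. *)
Lemma cpow1 t : t != 0 -> cpow t 1 = t.
Proof.
move=> t0; rewrite /cpow cpow_arg_neq0// mul1r /cexp /= cos_carg// sin_carg//.
have c0 : 0 < cabs t by rewrite cabs_gt0.
rewrite lnK ?posrE//; apply/eqP; rewrite eq_complex /= !mul0r subr0 addr0.
have h x : cabs t * (x / cabs t) = x by rewrite mulrC divfK// gt_eqF.
by rewrite !h !eqxx.
Qed.

Lemma cpow_natM t a n : t != 0 -> cpow t (a * n%:R) = cpow t a ^+ n.
Proof.
move=> t0; elim: n => [|n IH].
  by rewrite mulr0 expr0 /cpow cpow_arg_neq0// mul0r cexp0.
by rewrite exprS -IH -cpowD// -[n.+1]add1n natrD mulrDr mulr1.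
Qed.

Lemma cabs_cpow t a x : t != 0 ->
  cabs (cpow t (a + x%:C)) = cabs (cpow t a) * cabs t `^ x.
Proof.
move=> t0; rewrite cpowD// cabsM /cpow !cpow_arg_neq0// !cabs_cexp.
congr (_ * _); rewrite Re_mul /= mul0r subr0 /powR.
by rewrite gt_eqF// cabs_gt0.
Qed.

End Powers.


(** * Affine change of variables for Lebesgue integrals *)

Section ChangeOfVariables.
Context {R : realType}.
Local Notation mu := (@lebesgue_measure R).

Lemma affine_preimage_itv (s c a b : R) : 0 < s ->
  (fun x => s * x + c) @^-1` `]a, b] = `](a - c) / s, (b - c) / s]%classic.
Proof.
move=> s0; apply/seteqP; split => x /=; rewrite !in_itv /=.
  by rewrite ltr_pdivrMr// ler_pdivlMr// ltrBlDr lerBrDr mulrC.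
by rewrite ltr_pdivrMr// ler_pdivlMr// ltrBlDr lerBrDr mulrC.
Qed.

Lemma measurable_affine (s c : R) (D : set R) :
  measurable_fun D (fun x : R => s * x + c).
Proof.
by apply: measurable_funD => //; apply: measurable_funM.
Qed.

(** The pushforward of [mu], rescaled by [s], gives every half-open interval its length, which
    characterizes Lebesgue measure. *)
Lemma lebesgue_measure_affine (s c : R) (s0 : 0 < s) (A : set R) :
  measurable A ->
  mu A = (s%:E * mu ((fun x : R => s * x + c)%R @^-1` A))%E.
Proof.
move=> mA.
have mphi : measurable_fun setT
    ((fun x => s * x + c) : measurableTypeR R -> measurableTypeR R).
  exact: measurable_affine.
pose nu := pushforward mu
  ((fun x => s * x + c) : measurableTypeR R -> measurableTypeR R).
apply: (@lebesgue_measure_unique R (mscale (NngNum (ltW s0)) nu)) => //.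
move=> _ [[a b]] _ <-.
transitivity (s%:E * mu ((fun x : R => s * x + c)%R @^-1` `]a, b]))%E => //.
rewrite affine_preimage_itv// !lebesgue_measure_itv/= !lte_fin.
rewrite ltr_pM2r ?invr_gt0// ltrD2r; case: ifPn => _; last by rewrite mule0.
rewrite -!EFinB -EFinM; congr EFin.
by rewrite -mulrBl mulrC divfK ?gt_eqF// opprB addrA subrK.
Qed.

Lemma ge0_integral_affine (s c : R) (f : R -> \bar R) : 0 < s ->
  measurable_fun setT f -> (forall x, 0 <= f x)%E ->
  (\int[mu]_x f x = s%:E * \int[mu]_x f (s * x + c)%R)%E.
Proof.
move=> s0 mf f0.
have mphi : measurable_fun setT
    ((fun x => s * x + c) : measurableTypeR R -> measurableTypeR R).
  exact: measurable_affine.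
pose nu := pushforward mu
  ((fun x => s * x + c) : measurableTypeR R -> measurableTypeR R).
rewrite [LHS](_ : _ = (\int[mscale (NngNum (ltW s0)) nu]_x f x)%E); last first.
  by apply: eq_measure_integral => A mA _; exact: lebesgue_measure_affine.
rewrite ge0_integral_mscale//=; congr (_ * _)%E.
by rewrite ge0_integral_pushforward.
Qed.

End ChangeOfVariables.


(** * The substitution x = s u, y = s (1 - u) in the quadrant *)

Section Simplex.
Context {R : realType}.
Local Notation mu := (@lebesgue_measure R).

(** No two-dimensional change of variables is involved: y = s - x at fixed x, then Tonelli, then x =
    s u at fixed s, which produces the Jacobian [s]. *)
Lemma tonelli_simplex (H : R -> R -> R) :
  measurable_fun setT (fun z : R * R => H z.1 z.2) ->
  (forall x y, 0 < x -> 0 < y -> 0 <= H x y) ->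
  (\int[mu]_(x in `]0%R, +oo[) \int[mu]_(y in `]0%R, +oo[) (H x y)%:E =
   \int[mu]_(s in `]0%R, +oo[) \int[mu]_(u in `]0%R, 1%R[)
     (s * H (s * u) (s * (1 - u)))%:E)%E.
Proof.
move=> mH H0.
(* The indicators carry the domain inside the integrand, so that the substitutions act on integrals
   over the whole line. *)
pose i (x : R) : R := \1_(`]0, +oo[%classic : set R) x.
have i1 x : 0 < x -> i x = 1.
  by move=> x0; rewrite /i indicE mem_set//= in_itv/= x0.
have i0 x : x <= 0 -> i x = 0.
  move=> x0; rewrite /i indicE memNset//= in_itv/= andbT.
  by apply/negP; rewrite -leNgt.
have mi : measurable_fun setT i by exact: measurable_indic.
pose G (z : R * R) := i z.1 * i z.2 * H z.1 z.2.
have G0 z : (0 <= (G z)%:E)%E.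
  rewrite lee_fin /G; have [z1|z1] := ltP 0 z.1; last by rewrite i0// !mul0r.
  have [z2|z2] := ltP 0 z.2; last by rewrite (i0 z.2)// mulr0 mul0r.
  by rewrite !i1// !mul1r H0.
have mG : measurable_fun setT (fun z : R * R => (G z)%:E).
  apply/measurable_EFinP; apply: measurable_funM => //.
  by apply: measurable_funM; apply: measurableT_comp.
transitivity (\int[mu]_x \int[mu]_y (G (x, y))%:E)%E.
  rewrite integral_mkcond; apply: eq_integral => x _.
  rewrite patchE; case: ifPn => [|]; last first.
    rewrite notin_setE /= in_itv /= andbT => /negP; rewrite -leNgt => x0.
    by rewrite integral0_eq// => y _; rewrite /G /= i0// !mul0r.
  rewrite inE /= in_itv /= andbT => x0.
  rewrite integral_mkcond; apply: eq_integral => y _.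
  rewrite patchE /G /= (i1 _ x0); case: ifPn => [|].
    by rewrite inE /= in_itv /= andbT => y0; rewrite i1// !mul1r.
  rewrite notin_setE /= in_itv /= andbT => /negP; rewrite -leNgt => y0.
  by rewrite i0// mulr0 mul0r.
(* The integrand in the coordinates (x, s), s = x + y. It vanishes for s <= 0, since x and s - x
   cannot then both be positive. *)
pose F (z : R * R) := (G (z.1, z.2 - z.1))%:E.
have mF : measurable_fun setT F.
  have h : measurable_fun setT (fun z : R * R => (z.1, z.2 - z.1)).
    by apply: measurable_fun_pair => //=; apply: measurable_funB.
  exact: (measurableT_comp mG h).
transitivity (\int[mu]_x \int[mu]_s F (x, s))%E.
  apply: eq_integral => x _.
  rewrite (@ge0_integral_affine _ 1 (- x))//; last first.
    exact: (measurableT_comp mG (pair1_measurable x)).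
  by rewrite mul1e; apply: eq_integral => s _; rewrite mul1r.
rewrite (@fubini_tonelli _ _ _ _ _ mu mu)//; last by move=> ?; exact: G0.
rewrite [RHS]integral_mkcond; apply: eq_integral => s _.
rewrite patchE; case: ifPn => [|]; last first.
  rewrite notin_setE /= in_itv /= andbT => /negP; rewrite -leNgt => s0.
  rewrite integral0_eq// => x _; rewrite /F /G /=.
  have [x0|x0] := ltP 0 x; last by rewrite i0// !mul0r.
  by rewrite (i0 (s - x)) ?mulr0 ?mul0r// subr_le0 (le_trans s0)// ltW.
rewrite inE /= in_itv /= andbT => s0.
rewrite (@ge0_integral_affine _ s 0)//; last 2 first.
- exact: (measurableT_comp mF (pair2_measurable s)).
- by move=> x; exact: G0.
rewrite -ge0_integralZl_EFin//; last 3 first.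
- by move=> x _; exact: G0.
- have h := measurableT_comp (pair2_measurable s) (@measurable_affine R s 0 setT).
  exact: (measurableT_comp mF h).
- exact: ltW.
rewrite [RHS]integral_mkcond; apply: eq_integral => u _.
rewrite patchE addr0 /F /G /= -[X in s - X]/(s * u).
have -> : s - s * u = s * (1 - u) by rewrite mulrBr mulr1.
case: ifPn => [|].
  rewrite inE /= in_itv /= => /andP[u0 u1].
  by rewrite !i1 ?mulr_gt0 ?subr_gt0// !mul1r EFinM.
rewrite notin_setE /= in_itv /= => /negP; rewrite negb_and -!leNgt => /orP[u0|u1].
  by rewrite i0 ?mul0r ?mule0// pmulr_rle0.
by rewrite (i0 (s * (1 - u))) ?mulr0 ?mul0r ?mule0// pmulr_rle0// subr_le0.
Qed.

End Simplex.



(** * Real series: domination and shifts *)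

Section RealSeries.
Context {R : realType}.
Implicit Types (u c : nat -> R).

Lemma cvg_series_dominated u c : (forall n, `|u n| <= c n) ->
  cvgn (series c) -> cvgn (series u).
Proof.
move=> uc cc; apply: normed_cvg; apply: series_le_cvg cc => n //=.
exact: (le_trans _ (uc n)).
Qed.

Lemma series_le_limn c n : (forall n, 0 <= c n) -> cvgn (series c) ->
  series c n <= limn (series c).
Proof.
by move=> c0 cc; apply: nondecreasing_cvgn_le => //; exact: nondecreasing_series.
Qed.

Lemma norm_series_le u c n : (forall n, `|u n| <= c n) -> cvgn (series c) ->
  `|series u n| <= limn (series c).
Proof.
move=> uc cc; apply: le_trans (series_le_limn n _ cc); last first.
  by move=> m; exact: (le_trans _ (uc m)).
by rewrite /series /= (le_trans (ler_norm_sum _ _ _))// ler_sum.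
Qed.

Lemma norm_limn_series_le u c : (forall n, `|u n| <= c n) -> cvgn (series c) ->
  `|limn (series u)| <= limn (series c).
Proof.
move=> uc cc; rewrite -lim_norm; last exact: cvg_series_dominated uc cc.
apply: limr_le; last by apply: nearW => n; exact: norm_series_le.
by apply: is_cvg_norm; exact: cvg_series_dominated uc cc.
Qed.

Lemma cvg_series_geometric_le u (C q : R) : 0 <= q < 1 ->
  (forall n, `|u n| <= C * q ^+ n) -> cvgn (series u).
Proof.
move=> /andP[q0 q1] uC; apply: cvg_series_dominated uC _.
by apply: is_cvg_geometric_series; rewrite ger0_norm.
Qed.

Lemma cvg_series_shift u m : cvgn (series (fun n => u (n + m)%N)) ->
  cvgn (series u).
Proof.
have e n : series u (n + m)%N = series (fun n => u (n + m)%N) n + series u m.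
  rewrite /series /= (@big_cat_nat _ _ _ m)//= ?leq_addl// addrC; congr (_ + _).
  by rewrite -{1}(add0n m) big_addn addnK.
move=> cu; apply/cvg_ex => /=.
exists (limn (series (fun n => u (n + m)%N)) + series u m).
rewrite -(cvg_shiftn m); rewrite (eq_cvg _ _ e).
by apply: cvgD cu _; exact: cvg_cst.
Qed.

Lemma cvg_series_S u : cvgn (series u) ->
  series (fun n => u n.+1) @ \oo --> limn (series u) - u 0%N.
Proof.
move=> cu; have -> : series (fun n => u n.+1) = fun n => series u n.+1 - u 0%N.
  apply/funext => n; rewrite /series /= [in RHS]big_ltn// addrC addKr.
  by rewrite big_add1.
by apply: cvgB; [rewrite cvg_shiftS|exact: cvg_cst].
Qed.

Lemma limn_series_S u : cvgn (series u) ->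
  limn (series u) = u 0%N + limn (series (fun n => u n.+1)).
Proof.
move=> /cvg_series_S h.
by rewrite (cvg_lim (@norm_hausdorff _ _) h) addrC subrK.
Qed.

End RealSeries.

(** * Termwise integration of real series *)

Section SeriesIntegral.
Context d (T : measurableType d) {R : realType} (mu : {measure set T -> \bar R}).
Variables (D : set T) (mD : measurable D).

Lemma integrable_EFinD (f g : T -> R) : mu.-integrable D (EFin \o f) ->
  mu.-integrable D (EFin \o g) -> mu.-integrable D (EFin \o (fun x => f x + g x)).
Proof. by move=> If Ig; apply: eq_integrable (integrableD mD If Ig). Qed.

Lemma integrable_EFinZ (f : T -> R) (r : R) : mu.-integrable D (EFin \o f) ->
  mu.-integrable D (EFin \o (fun x => r * f x)).
Proof. by move=> If; apply: eq_integrable (integrableZl mD r If). Qed.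

(** The product form of the majorant bounds every partial sum by the single function
    [limn (series c) * g x], so dominated convergence applies to the partial sums. *)
Lemma Rintegral_series_limn (u : nat -> T -> R) (c : nat -> R) (g : T -> R) :
  (forall n, measurable_fun D (u n)) -> (forall n, 0 <= c n) ->
  cvgn (series c) -> mu.-integrable D (EFin \o g) ->
  (forall n x, D x -> `|u n x| <= c n * g x) ->
  mu.-integrable D (EFin \o (fun x => limn (series (u ^~ x)))) /\
  (series (fun n => Rintegral mu D (u n))) @ \oo -->
    Rintegral mu D (fun x => limn (series (u ^~ x))).
Proof.
move=> mu_ c0 cc ig ug.
have iu n : mu.-integrable D (EFin \o u n).
  apply: le_integrable (integrableZl mD (c n) ig) => //.
    exact/measurable_EFinP.
  by move=> x Dx /=; rewrite lee_fin; apply: le_trans (ler_norm _); exact: ug.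
have msum n : measurable_fun D (fun x => series (u ^~ x) n).
  by rewrite /series /=; apply: measurable_sum.
have cu x : D x -> cvgn (series (u ^~ x)).
  move=> Dx; apply: (@cvg_series_dominated _ _ (fun n => c n * g x)).
    by move=> n; exact: ug.
  have -> : (fun n => c n * g x) = g x *: c by apply/funext => n; rewrite mulrC.
  exact: is_cvg_seriesZ.
have mlim : measurable_fun D (fun x => limn (series (u ^~ x))).
  apply: (measurable_fun_cvg (h := fun n x => series (u ^~ x) n)) => //.
have bound n x : D x -> `|series (u ^~ x) n| <= limn (series c) * g x.
  move=> Dx; rewrite [in leLHS]/series /=.
  apply: (le_trans (ler_norm_sum _ _ _)).
  apply: (@le_trans _ _ (\sum_(0 <= k < n) c k * g x)).
    by apply: ler_sum => k _; exact: ug.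
  rewrite -mulr_suml; have [gx|gx] := leP 0 (g x).
    by rewrite ler_wpM2r//; exact: series_le_limn.
  (* No sign is assumed for [g]: where it is negative, 0 <= |u k x| <= c k * g x forces every [c k]
     to vanish. *)
  have ck k : c k = 0.
    apply/eqP; rewrite eq_le c0 andbT -(ler_nM2r gx) mul0r.
    exact: le_trans (ug k _ Dx).
  have -> : c = (fun=> 0) by apply/funext.
  rewrite (_ : series _ = fun=> 0) ?lim_cst ?big1 ?mul0r//.
  by apply/funext => k; rewrite /series /= big1.
have [|||||il _ cl] := @dominated_convergence _ _ _ mu D mD
  (fun n x => (series (u ^~ x) n)%:E) (fun x => (limn (series (u ^~ x)))%:E)
  (fun x => (limn (series c) * g x)%:E).
- by move=> n; exact/measurable_EFinP.
- exact/measurable_EFinP.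
- by apply: aeW => x Dx; apply: cvg_EFin; [exact: nearW|exact: cu].
- exact: (integrableZl mD (limn (series c)) ig).
- by apply: aeW => x n Dx; rewrite lee_fin; exact: bound.
split; first exact: il.
have e n : (\int[mu]_(x in D) (series (u ^~ x) n)%:E =
    (series (fun n => Rintegral mu D (u n)) n)%:E)%E.
  transitivity (\int[mu]_(x in D) \sum_(0 <= k < n) (u k x)%:E)%E.
    by apply: eq_integral => x _; rewrite sumEFin.
  rewrite integral_sum// /series /= -sumEFin; apply: eq_bigr => k _.
  by rewrite /Rintegral (fineK (integrable_fin_num mD (iu k))).
have cl' : (fun n => (series (fun n => Rintegral mu D (u n)) n)%:E) @ \oo -->
    (\int[mu]_(x in D) (limn (series (u ^~ x)))%:E)%E.
  by apply: cvg_trans cl; apply: near_eq_cvg; apply: nearW => n /=; rewrite e.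
apply: (fine_cvg (f := fun n => (series (fun n => Rintegral mu D (u n)) n)%:E)).
by rewrite /Rintegral fineK//; exact: integrable_fin_num.
Qed.

End SeriesIntegral.



(** * Complex series, componentwise *)

Section ComplexSeries.
Context {R : realType}.
Implicit Types (u w : nat -> R[i]) (a : R[i]) (c : nat -> R).

Lemma cvg_csum_le u c : (forall n, cabs (u n) <= c n) -> cvgn (series c) ->
  cvg_csum u.
Proof.
move=> uc cc; split; apply: cvg_series_dominated cc => n;
  apply: le_trans (uc n); [exact: Re_le_cabs|exact: Im_le_cabs].
Qed.

(** The factor 2 comes from bounding the two components separately; the later estimates only need
    some finite constant. *)
Lemma cabs_csum_le u c : (forall n, cabs (u n) <= c n) -> cvgn (series c) ->
  cabs (csum u) <= 2 * limn (series c).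
Proof.
move=> uc cc; rewrite mulr_natl mulr2n; apply: le_trans (cabs_le _) _.
apply: lerD; apply: norm_limn_series_le cc => n; apply: le_trans (uc n).
  exact: Re_le_cabs.
exact: Im_le_cabs.
Qed.

Lemma csumB u w : cvg_csum u -> cvg_csum w ->
  cvg_csum (fun n => u n - w n) /\ csum (fun n => u n - w n) = csum u - csum w.
Proof.
move=> [u1 u2] [w1 w2].
have e1 : (fun n => complex.Re (u n - w n)) =
    (fun n => complex.Re (u n)) - (fun n => complex.Re (w n)).
  by apply/funext => n; rewrite Re_add Re_opp.
have e2 : (fun n => complex.Im (u n - w n)) =
    (fun n => complex.Im (u n)) - (fun n => complex.Im (w n)).
  by apply/funext => n; rewrite Im_add Im_opp.
split; first by split; rewrite ?e1 ?e2; exact: is_cvg_seriesB.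
by rewrite /csum e1 e2 !lim_seriesB.
Qed.

Lemma csumZ a u : cvg_csum u ->
  cvg_csum (fun n => a * u n) /\ csum (fun n => a * u n) = a * csum u.
Proof.
move=> [u1 u2].
have e1 : (fun n => complex.Re (a * u n)) =
    complex.Re a *: (fun n => complex.Re (u n))
    - complex.Im a *: (fun n => complex.Im (u n)).
  by apply/funext => n; rewrite Re_mul.
have e2 : (fun n => complex.Im (a * u n)) =
    complex.Re a *: (fun n => complex.Im (u n))
    + complex.Im a *: (fun n => complex.Re (u n)).
  by apply/funext => n; rewrite Im_mul.
split.
  split; rewrite ?e1 ?e2; [apply: is_cvg_seriesB|apply: is_cvg_seriesD];
    exact: is_cvg_seriesZ.
have Z (w : nat -> R) r : cvgn (series w) -> cvgn (series (r *: w)).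
  exact: is_cvg_seriesZ.
rewrite {1}/csum e1 e2 lim_seriesB ?lim_seriesD; try exact: Z.
rewrite !lim_seriesZ//.
by apply: complex_ext; rewrite ?Re_mul ?Im_mul.
Qed.

Lemma csum_S u : cvg_csum u -> csum u = u 0%N + csum (fun n => u n.+1).
Proof.
move=> [u1 u2]; apply: complex_ext; rewrite ?Re_add ?Im_add /csum /=.
  exact: limn_series_S.
exact: limn_series_S.
Qed.

End ComplexSeries.

(** * Measurability of complex-valued functions *)

Section ComplexMeasurable.
Context d (T : measurableType d) {R : realType}.
Implicit Types (D : set T) (f g : T -> R[i]) (a : R[i]).

Definition cmeasurable D f :=
  measurable_fun D (fun x => complex.Re (f x)) /\
  measurable_fun D (fun x => complex.Im (f x)).

Lemma cmeasurable_cst D a : cmeasurable D (fun=> a).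
Proof. by split; exact: measurable_cst. Qed.

Lemma cmeasurableM D f g : cmeasurable D f -> cmeasurable D g ->
  cmeasurable D (fun x => f x * g x).
Proof.
move=> [f1 f2] [g1 g2]; split.
  under eq_fun do rewrite Re_mul.
  by apply: measurable_funB; apply: measurable_funM.
under eq_fun do rewrite Im_mul.
by apply: measurable_funD; apply: measurable_funM.
Qed.

Lemma cmeasurable_real D (h : T -> R) : measurable_fun D h ->
  cmeasurable D (fun x => (h x)%:C).
Proof. by move=> mh; split => //=; exact: measurable_cst. Qed.

Lemma measurable_cabs D f : cmeasurable D f -> measurable_fun D (cabs \o f).
Proof.
move=> [f1 f2]; rewrite /comp; under eq_fun do rewrite cabs_sqrt.
apply: (@measurableT_comp _ _ _ _ _ _ (@Num.sqrt R)).
  by apply: continuous_measurable_fun; exact: sqrt_continuous.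
by apply: measurable_funD; exact: measurable_funX.
Qed.

Lemma cmeasurable_rpow D (h : T -> R) a : measurable_fun D h ->
  cmeasurable D (fun x => rpow (h x) a).
Proof.
move=> mh.
have ml b : measurable_fun D (fun x => b * ln (h x)).
  apply: measurable_funM => //.
  by apply: (measurableT_comp (@measurable_ln R)).
have mc : measurable_fun setT (@cos R).
  by apply: continuous_measurable_fun; exact: continuous_cos.
have ms : measurable_fun setT (@sin R).
  by apply: continuous_measurable_fun; exact: continuous_sin.
have e x : rpow x a = (expR (complex.Re a * ln x))%:C *
    (cos (complex.Im a * ln x) +i* sin (complex.Im a * ln x)).
  by rewrite /rpow /cexp; case: a => ? ?; simpc.
under eq_fun do rewrite e.
apply: cmeasurableM.
  by apply: cmeasurable_real; exact: (measurableT_comp (@measurable_expR R)).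
by split => /=; [exact: (measurableT_comp mc)|exact: (measurableT_comp ms)].
Qed.

End ComplexMeasurable.

(** * Complex integrals and their exchange with series *)

Section ComplexIntegral.
Context {R : realType}.
Local Notation mu := (@lebesgue_measure R).
Implicit Types (f : R -> R[i]) (a : R[i]).

Variables (D : set R) (mD : measurable D).

Lemma cintegrable_cmeasurable f : cintegrable D f -> cmeasurable D f.
Proof.
move=> [/measurable_int/measurable_EFinP ?].
by move=> /measurable_int/measurable_EFinP.
Qed.

Lemma cintegrable_le f (g : R -> R) : cmeasurable D f ->
  mu.-integrable D (EFin \o g) -> (forall x, D x -> cabs (f x) <= g x) ->
  cintegrable D f.
Proof.
move=> [f1 f2] ig fg; split; apply: le_integrable ig => //.
- exact/measurable_EFinP.
- move=> x Dx; rewrite /= lee_fin (le_trans (Re_le_cabs _))//.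
  exact: le_trans (fg _ Dx) (ler_norm _).
- exact/measurable_EFinP.
- move=> x Dx; rewrite /= lee_fin (le_trans (Im_le_cabs _))//.
  exact: le_trans (fg _ Dx) (ler_norm _).
Qed.

Lemma cintegrable_cabs f : cintegrable D f -> mu.-integrable D (EFin \o (cabs \o f)).
Proof.
move=> If; have mf := cintegrable_cmeasurable If; case: If => f1 f2.
have h : mu.-integrable D
    (EFin \o (fun x => `|complex.Re (f x)| + `|complex.Im (f x)|)).
  by apply: integrable_EFinD => //;
    [exact: integrable_norm f1|exact: integrable_norm f2].
apply: le_integrable h => //.
  by apply/measurable_EFinP; exact: measurable_cabs.
move=> x Dx /=; rewrite lee_fin (ger0_norm (cabs_ge0 _)).
exact: le_trans (cabs_le _) (ler_norm _).
Qed.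

Lemma eq_cintegral f g : {in D, f =1 g} -> cintegral D f = cintegral D g.
Proof.
by move=> fg; rewrite /cintegral; congr (_ +i* _); apply: eq_Rintegral => x Dx;
  rewrite fg.
Qed.

Lemma eq_cintegrable f g : {in D, f =1 g} -> cintegrable D f -> cintegrable D g.
Proof.
move=> fg [f1 f2]; split.
  by apply: eq_integrable f1 => // x Dx /=; rewrite fg.
by apply: eq_integrable f2 => // x Dx /=; rewrite fg.
Qed.

Lemma cintegrableZl f a : cintegrable D f -> cintegrable D (fun x => a * f x).
Proof.
move=> If; apply: (@cintegrable_le _ (fun x => cabs a * cabs (f x))).
- by apply: cmeasurableM; [exact: cmeasurable_cst|exact: cintegrable_cmeasurable].
- by apply: integrable_EFinZ => //; exact: cintegrable_cabs.
- by move=> x _; rewrite cabsM.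
Qed.

Lemma cintegralZl f a : cintegrable D f ->
  cintegral D (fun x => a * f x) = a * cintegral D f.
Proof.
move=> [f1 f2]; apply: complex_ext; rewrite ?Re_mul ?Im_mul /cintegral /=.
  under eq_Rintegral do rewrite Re_mul.
  by rewrite RintegralB// ?RintegralZl//; apply: integrable_EFinZ.
under eq_Rintegral do rewrite Im_mul.
by rewrite RintegralD// ?RintegralZl//; apply: integrable_EFinZ.
Qed.

(** Serves twice: for the Mittag-Leffler series in n inside one term of the solution, and for the
    series of the solution in r. *)
Lemma cintegral_csum (u : nat -> R -> R[i]) (c : nat -> R) (g : R -> R) :
  (forall n, cmeasurable D (u n)) -> (forall n, 0 <= c n) ->
  cvgn (series c) -> mu.-integrable D (EFin \o g) ->
  (forall n x, D x -> cabs (u n x) <= c n * g x) ->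
  [/\ forall x, D x -> cvg_csum (u ^~ x),
      cintegrable D (fun x => csum (u ^~ x)),
      cvg_csum (fun n => cintegral D (u n)) &
      cintegral D (fun x => csum (u ^~ x)) = csum (fun n => cintegral D (u n))].
Proof.
move=> mu_ c0 cc ig ug.
have [] := @Rintegral_series_limn _ _ _ mu D mD
  (fun n x => complex.Re (u n x)) c g _ c0 cc ig _.
- by move=> n; case: (mu_ n).
- by move=> n x Dx; exact: le_trans (Re_le_cabs _) (ug _ _ Dx).
move=> i1 l1.
have [] := @Rintegral_series_limn _ _ _ mu D mD
  (fun n x => complex.Im (u n x)) c g _ c0 cc ig _.
- by move=> n; case: (mu_ n).
- by move=> n x Dx; exact: le_trans (Im_le_cabs _) (ug _ _ Dx).
move=> i2 l2; split.
- move=> x Dx; apply: (@cvg_csum_le _ _ (fun n => c n * g x)).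
    by move=> n; exact: ug.
  have -> : (fun n => c n * g x) = g x *: c by apply/funext => n; rewrite mulrC.
  exact: is_cvg_seriesZ.
- by split.
- by split; apply/cvg_ex; eexists; [exact: l1|exact: l2].
- rewrite /cintegral /csum /=; congr (_ +i* _).
    by rewrite (cvg_lim (@norm_hausdorff _ _) l1).
  by rewrite (cvg_lim (@norm_hausdorff _ _) l2).
Qed.

End ComplexIntegral.



(** * Integrability of the real Gamma integrand *)

Section GammaIntegrable.
Context {R : realType}.
Local Notation mu := (@lebesgue_measure R).
Implicit Types (a x : R).

Lemma measurable_powRB1 a (D : set R) : measurable_fun D (fun x => x `^ (a - 1)).
Proof. by apply: measurable_funTS; exact: measurable_powR. Qed.

Lemma integral_powR a e : 0 < a -> 0 < e < 1 ->
  (\int[mu]_(x in `[e, 1%R]) (x `^ (a - 1))%:E = ((1 - e `^ a) / a)%:E)%E.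
Proof.
move=> a0 /andP[e0 e1].
have pos x : x \in `[e, 1] -> 0 < x.
  by rewrite in_itv /= => /andP[ex _]; exact: lt_le_trans ex.
have cont b x : 0 < x -> {for x, continuous (fun y : R => y `^ b)}.
  move=> x0; apply/differentiable_continuous/derivable1_diffP.
  by apply: derivable_powR; rewrite in_itv /= x0.
rewrite (@continuous_FTC2 _ _ (fun x => a^-1 * x `^ a))//.
- by rewrite powR1 -EFinB -mulrBr mulrC.
- apply: continuous_in_subspaceT => x; rewrite inE => xe.
  by apply: cont; exact: pos.
- split.
  + move=> x xe; apply: derivableM => //; apply: derivable_powR.
    by rewrite in_itv /= pos// subset_itv_oo_cc.
  + apply: cvg_at_right_filter; apply: cvgM; first exact: cvg_cst.
    exact: cont.
  + apply: cvg_at_left_filter; apply: cvgM; first exact: cvg_cst.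
    exact: cont.
- move=> x xe; have x0 : 0 < x by apply: pos; exact: subset_itv_oo_cc.
  rewrite derive1E deriveM//; last first.
    by apply: derivable_powR; rewrite in_itv /= x0.
  rewrite derive_cst scaler0 addr0 -derive1E.
  have x0' : x \in `]0, +oo[ by rewrite in_itv /= x0.
  rewrite (powR_derive1 a x0').
  by rewrite /GRing.scale /= mulrA mulVf ?mul1r// gt_eqF.
Qed.

Lemma integrable_powR01 a : 0 < a ->
  mu.-integrable `]0, 1] (EFin \o (fun x => x `^ (a - 1))).
Proof.
move=> a0; apply/integrableP; split.
  by apply/measurable_EFinP; exact: measurable_powRB1.
(* The index [n.+2] keeps the left end strictly below 1, as [integral_powR] requires. On each of
   these intervals the integral is at most 1 / a. *)
pose F (n : nat) : set R := `[n.+2%:R^-1, 1]%classic.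
have -> : `]0, 1]%classic = \bigcup_n F n.
  apply/seteqP; split => x /=.
    rewrite in_itv /= => /andP[x0 x1].
    have [n nx] : exists n, n.+1%:R^-1 < x.
      exists (Num.truncn x^-1).+1; rewrite invf_plt ?posrE//.
      by rewrite (lt_trans (truncnS_gt _))// ltr_nat.
    exists n => //; rewrite /F /= in_itv /= x1 andbT; apply: le_trans (ltW nx).
    by rewrite lef_pV2 ?posrE// ler_nat.
  move=> [n _]; rewrite /F /= !in_itv /= => /andP[nx ->]; rewrite andbT.
  by apply: lt_le_trans nx; rewrite invr_gt0.
have nF : nondecreasing_seq F.
  move=> m n mn; rewrite subsetEset /F => x /=; rewrite !in_itv /=.
  move=> /andP[mx ->]; rewrite andbT; apply: le_trans mx.
  by rewrite lef_pV2 ?posrE// ler_nat !ltnS.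
pose g (x : R) := `|(x `^ (a - 1))%:E|%E.
have := @ge0_nondecreasing_set_cvg_integral _ (measurableTypeR R) R F
  g mu nF.
have mF i : measurable (F i) by exact: measurable_itv.
move=> /(_ mF).
have mf i : measurable_fun (F i)
    g.
  apply: measurableT_comp => //; apply/measurable_EFinP.
  exact: measurable_powRB1.
move=> /(_ mf) /(_ (fun _ _ _ => abse_ge0 _)) cF.
apply: (@le_lt_trans _ _ (a^-1)%:E); last exact: ltry.
rewrite -(cvg_lim _ cF)//; apply: lime_le.
  by apply/cvg_ex; eexists; exact: cF.
apply: nearW => n.
under eq_integral => x _ do rewrite /g abse_EFin ger0_norm ?powR_ge0//.
rewrite integral_powR//; last first.
  by rewrite invr_gt0 ltr0n /= invf_lt1// ltr1n.
by rewrite lee_fin ler_pdivrMr// mulVf ?gt_eqF// lerBlDr lerDl powR_ge0.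
Qed.

Definition gammaf a x : R := x `^ (a - 1) * expR (- x).

Lemma gammaf_ge0 a x : 0 <= gammaf a x.
Proof. by rewrite mulr_ge0 ?powR_ge0 ?expR_ge0. Qed.

Lemma measurable_gammaf a (D : set R) : measurable_fun D (gammaf a).
Proof.
apply: measurable_funM; first exact: measurable_powRB1.
apply: (measurableT_comp (@measurable_expR R)).
exact: measurable_funTS.
Qed.

Lemma gammaf_le_exp a : exists C, forall x, 1 <= x ->
  gammaf a x <= C * expR (- 2^-1 * x).
Proof.
have [a1|a1] := leP a 1.
  exists 1 => x x1; rewrite /gammaf; apply: ler_pM; rewrite ?powR_ge0 ?expR_ge0//.
  - by rewrite -[leRHS](powRr0 x); apply: ler_powR => //; rewrite subr_le0.
  - rewrite ler_expR mulNr lerN2 ler_piMl//; first exact: le_trans x1.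
    by rewrite invf_le1// ler1n.
pose b := 2 * (a - 1).
have b0 : 0 < b by rewrite mulr_gt0// subr_gt0.
(* ln (x / b) <= x / b - 1 turns x^(a-1) into at most b^(a-1) e^(x/2). *)
exists (expR ((a - 1) * ln b)) => x x1.
have x0 : 0 < x by exact: lt_le_trans x1.
rewrite /gammaf /powR gt_eqF// -!expRD ler_expR.
have : ln (x / b) <= x / b - 1.
  rewrite -{1}[x / b](subrK 1) addrC le_ln1Dx//.
  by rewrite ltrBrDr addrC subrr divr_gt0.
rewrite ln_div ?posrE// => h.
have : (a - 1) * (ln x - ln b) <= (a - 1) * (x / b).
  apply: ler_wpM2l; first by rewrite subr_ge0 ltW.
  by apply: le_trans h _; rewrite gerBl.
have -> : (a - 1) * (x / b) = x / 2.
  by rewrite /b; field; rewrite gt_eqF// subr_gt0.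
rewrite mulrBr; lra.
Qed.

Lemma integrable_gammaf a : 0 < a -> mu.-integrable `]0, +oo[ (EFin \o gammaf a).
Proof.
move=> a0; have mg := measurable_gammaf a.
have i1 : mu.-integrable `]0, 1] (EFin \o gammaf a).
  apply: le_integrable (integrable_powR01 a0) => //.
    by apply/measurable_EFinP; exact: mg.
  move=> x; rewrite /= in_itv /= => /andP[x0 _].
  rewrite lee_fin !ger0_norm ?powR_ge0 ?gammaf_ge0//.
  by rewrite ler_piMr ?powR_ge0// expR_le1 oppr_le0 ltW.
have i2 : mu.-integrable `[1, +oo[ (EFin \o gammaf a).
  have [C hC] := gammaf_le_exp a.
  have ie : mu.-integrable `[1, +oo[ (EFin \o exponential_pdf (2^-1 : R)).
    apply: (@integrableS _ _ _ mu setT) => //.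
    by apply: integrable_exponential_pdf; rewrite invr_gt0.
  (* The factor 2 cancels the normalization 1/2 of the exponential density of rate 1/2. *)
  have ie2 : mu.-integrable `[1, +oo[
      (EFin \o (fun x => C * 2 * exponential_pdf (2^-1 : R) x)).
    by apply: integrable_EFinZ.
  apply: le_integrable ie2 => //.
    by apply/measurable_EFinP; exact: mg.
  move=> x; rewrite /= in_itv /= andbT => x1.
  have x0 : 0 <= x by exact: le_trans x1.
  rewrite lee_fin (ger0_norm (gammaf_ge0 _ _)); apply: le_trans (ler_norm _).
  by rewrite exponential_pdfE// mulrA mulfK ?hC// pnatr_eq0.
have e : `]0, +oo[%classic = `]0, 1] `|` `]1, +oo[ :> set R.
  by rewrite -itv_bndbnd_setU// bnd_simp.
apply/integrableP; split; first by apply/measurable_EFinP; exact: mg.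
rewrite e ge0_integral_setU//; last 2 first.
- apply: measurableT_comp => //; by apply/measurable_EFinP; exact: mg.
- apply/disj_setPS => x [] /=; rewrite !in_itv /= andbT => /andP[_ x1].
  by rewrite ltNge x1.
apply: lte_add_pinfty; first by move/integrableP : i1 => [].
have : mu.-integrable `]1, +oo[ (EFin \o gammaf a).
  apply: (@integrableS _ _ _ mu `[1, +oo[) => //.
  by move=> x /=; rewrite !in_itv /= !andbT => /ltW.
by move/integrableP => [].
Qed.

End GammaIntegrable.



(** * The quadrant substitution for complex integrands *)

Section ComplexTonelli.
Context {R : realType}.
Local Notation mu := (@lebesgue_measure R).
Local Notation R0y := (`]0, +oo[%classic : set R).
Local Notation R01 := (`]0, 1[%classic : set R).

(** Integration preserves this shape: the inner integral, as a function of the outer variable, is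
    again of the form integrated here, so the lemma evaluates both levels of a double integral. *)
Lemma integral_cabsDRe (D : set R) (mD : measurable D) (h : R -> R[i])
    (a : R) (z : R[i]) : cintegrable D h ->
  (\int[mu]_(x in D) (a * cabs (h x) + complex.Re (z * h x))%:E =
   (a * Rintegral mu D (cabs \o h) + complex.Re (z * cintegral D h))%:E)%E.
Proof.
move=> ih; have i1 : mu.-integrable D (EFin \o (fun x => a * cabs (h x))).
  by apply: integrable_EFinZ => //; exact: cintegrable_cabs.
have [i2 _] := cintegrableZl mD z ih.
have i12 : mu.-integrable D
    (EFin \o (fun x => a * cabs (h x) + complex.Re (z * h x))).
  exact: integrable_EFinD.
rewrite -cintegralZl// -RintegralZl//; last exact: cintegrable_cabs.
by rewrite -RintegralD// /Rintegral fineK//; exact: integrable_fin_num.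
Qed.

(* Tonelli needs nonnegative integrands: it is applied to |f g| and to
   |f g| + Re (f g), and the results are subtracted. *)
Lemma Re_cintegral_simplex (f g S U : R -> R[i]) :
  cmeasurable setT f -> cmeasurable setT g ->
  cmeasurable R01 U ->
  cintegrable R0y f -> cintegrable R0y g -> cintegrable R0y S ->
  0 < Rintegral mu R0y (cabs \o S) ->
  (forall s u, 0 < s -> 0 < u < 1 ->
    s%:C * (f (s * u) * g (s * (1 - u))) = S s * U u) ->
  cintegrable R01 U /\
  complex.Re (cintegral R0y f * cintegral R0y g) =
  complex.Re (cintegral R0y S * cintegral R01 U).
Proof.
move=> mf mg mU If Ig IS S0 fgSU.
have m1 : measurable R01 by exact: measurable_itv.
have my : measurable R0y by exact: measurable_itv.
have E (h : R -> R[i]) (D : set R) : measurable D -> cintegrable D h ->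
    (\int[mu]_(x in D) (cabs (h x))%:E = (Rintegral mu D (cabs \o h))%:E)%E.
  move=> mD ih; rewrite /Rintegral fineK//.
  by apply: integrable_fin_num => //; exact: cintegrable_cabs.
have mcabs (h : R -> R[i]) : cmeasurable setT h -> measurable_fun setT (cabs \o h).
  exact: measurable_cabs.
have mfg : cmeasurable setT (fun z : R * R => f z.1 * g z.2).
  case: mf => f1 f2; case: mg => g1 g2; apply: cmeasurableM; split.
  - exact: (measurableT_comp f1).
  - exact: (measurableT_comp f2).
  - exact: (measurableT_comp g1).
  - exact: (measurableT_comp g2).
have mU' : measurable_fun R01 (cabs \o U) by exact: measurable_cabs.
have A1 : ((Rintegral mu R0y (cabs \o f) * Rintegral mu R0y (cabs \o g))%:E =
    (Rintegral mu R0y (cabs \o S))%:E * \int[mu]_(u in R01) (cabs (U u))%:E)%E.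
  have := @tonelli_simplex R (fun x y => cabs (f x * g y)).
  move=> /(_ (measurable_cabs mfg) (fun _ _ _ _ => cabs_ge0 _)).
  have -> : (\int[mu]_(x in R0y) \int[mu]_(y in R0y) (cabs (f x * g y))%:E =
      (Rintegral mu R0y (cabs \o f) * Rintegral mu R0y (cabs \o g))%:E)%E.
    transitivity (\int[mu]_(x in R0y)
        (Rintegral mu R0y (cabs \o g) * cabs (f x))%:E)%E.
      apply: eq_integral => x _; under eq_integral do rewrite cabsM EFinM.
      rewrite ge0_integralZl_EFin ?cabs_ge0//.
      - by rewrite E// -EFinM mulrC.
      - by move=> y _; rewrite lee_fin cabs_ge0.
      - by apply/measurable_EFinP; apply: measurable_funTS; exact: mcabs.
    have g0 : 0 <= Rintegral mu R0y (cabs \o g).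
      by apply: Rintegral_ge0 => x _; exact: cabs_ge0.
    under eq_integral do rewrite EFinM.
    rewrite ge0_integralZl_EFin//.
    - by rewrite E// -EFinM mulrC.
    - by move=> y _; rewrite lee_fin cabs_ge0.
    - by apply/measurable_EFinP; apply: measurable_funTS; exact: mcabs.
  move=> ->; transitivity (\int[mu]_(s in R0y)
      ((cabs (S s))%:E * \int[mu]_(u in R01) (cabs (U u))%:E))%E.
    apply: eq_integral => s; rewrite inE /= in_itv /= andbT => s0.
    rewrite -ge0_integralZl_EFin ?cabs_ge0//; last 2 first.
    - by move=> y _; rewrite lee_fin cabs_ge0.
    - by apply/measurable_EFinP.
    apply: eq_integral => u; rewrite inE /= in_itv /= => u01.
    by rewrite -EFinM -cabsM -fgSU// [in RHS]cabsM cabsR gtr0_norm.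
  rewrite ge0_integralZr//; last 3 first.
  - apply/measurable_EFinP; apply: measurable_cabs.
    exact: cintegrable_cmeasurable.
  - by move=> y _; rewrite lee_fin cabs_ge0.
  - by apply: integral_ge0 => u _; rewrite lee_fin cabs_ge0.
  by congr (_ * _)%E; exact: E.
(* By [A1], an infinite integral of |U|, multiplied by the positive integral of |S|, would equal a
   finite number. *)
have IU : cintegrable R01 U.
  apply: (@cintegrable_le _ _ m1 _ (cabs \o U)) => //.
  apply/integrableP; split; first exact/measurable_EFinP.
  under eq_integral do rewrite /= ger0_norm ?cabs_ge0//.
  rewrite ltey; apply/eqP => h; move: A1.
  by rewrite h gt0_muley ?lte_fin.
split=> //; rewrite E// -EFinM in A1; case: A1 => A1.
have := @tonelli_simplex R
  (fun x y => cabs (f x) * cabs (g y) + complex.Re (f x * g y)).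
have mH : measurable_fun setT (fun z : R * R =>
    cabs (f z.1) * cabs (g z.2) + complex.Re (f z.1 * g z.2)).
  apply: measurable_funD; last by case: mfg.
  apply: measurable_funM.
    exact: (measurableT_comp (mcabs _ mf)).
  exact: (measurableT_comp (mcabs _ mg)).
move=> /(_ mH).
have H0 x y : 0 <= cabs (f x) * cabs (g y) + complex.Re (f x * g y).
  by rewrite -cabsM -lerBlDl sub0r; have := Re_le_cabs (f x * g y);
    rewrite ler_norml => /andP[].
move=> /(_ (fun x y _ _ => H0 x y)).
have -> : (\int[mu]_(x in R0y) \int[mu]_(y in R0y)
    (cabs (f x) * cabs (g y) + complex.Re (f x * g y))%:E =
    (Rintegral mu R0y (cabs \o g) * Rintegral mu R0y (cabs \o f) +
     complex.Re (cintegral R0y g * cintegral R0y f))%:E)%E.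
  rewrite -integral_cabsDRe//; apply: eq_integral => x _.
  by rewrite integral_cabsDRe// mulrC (mulrC (f x)).
have -> : (\int[mu]_(s in R0y) \int[mu]_(u in R01)
    (s * (cabs (f (s * u)) * cabs (g (s * (1 - u))) +
      complex.Re (f (s * u) * g (s * (1 - u)))))%:E =
    (Rintegral mu R01 (cabs \o U) * Rintegral mu R0y (cabs \o S) +
     complex.Re (cintegral R01 U * cintegral R0y S))%:E)%E.
  rewrite -integral_cabsDRe//; apply: eq_integral => s.
  rewrite inE /= in_itv /= andbT => s0.
  transitivity (\int[mu]_(u in R01)
      (cabs (S s) * cabs (U u) + complex.Re (S s * U u))%:E)%E.
    apply: eq_integral => u; rewrite inE /= in_itv /= => u01.
    rewrite -!cabsM -!fgSU//; move: (f _ * g _) => w.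
    rewrite cabsM cabsR gtr0_norm// Re_mul /= mul0r subr0.
    by rewrite mulrDr.
  by rewrite integral_cabsDRe// mulrC (mulrC (S s)).
move/eqP; rewrite eqe => /eqP.
rewrite (mulrC (Rintegral mu R0y (cabs \o g))) A1.
rewrite (mulrC (Rintegral mu R01 (cabs \o U))) => /addrI.
by rewrite (mulrC (cintegral R0y g)) (mulrC (cintegral R01 U)).
Qed.

(* The imaginary part is the real part for - i f and - i S. *)
Lemma cintegral_simplex (f g S U : R -> R[i]) :
  cmeasurable setT f -> cmeasurable setT g ->
  cmeasurable R01 U ->
  cintegrable R0y f -> cintegrable R0y g -> cintegrable R0y S ->
  0 < Rintegral mu R0y (cabs \o S) ->
  (forall s u, 0 < s -> 0 < u < 1 ->
    s%:C * (f (s * u) * g (s * (1 - u))) = S s * U u) ->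
  cintegrable R01 U /\
  cintegral R0y f * cintegral R0y g = cintegral R0y S * cintegral R01 U.
Proof.
move=> mf mg mU If Ig IS S0 fgSU.
have my : measurable R0y by exact: measurable_itv.
have [IU eRe] := Re_cintegral_simplex mf mg mU If Ig IS S0 fgSU.
split=> //; apply: complex_ext => //.
pose a : R[i] := 0 +i* -1.
have Rea z : complex.Re (a * z) = complex.Im z.
  by rewrite Re_mul /= mul0r sub0r mulN1r opprK.
have [||||||||_] := @Re_cintegral_simplex (fun x => a * f x) g (fun x => a * S x) U.
- by apply: cmeasurableM => //; exact: cmeasurable_cst.
- by [].
- by [].
- exact: cintegrableZl.
- by [].
- exact: cintegrableZl.
- rewrite (_ : cabs \o (fun x => a * S x) = cabs \o S)//; apply/funext => x /=.
  by rewrite cabsM cabs_sqrt /= expr0n add0r sqrrN expr1n sqrtr1 mul1r.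
- by move=> s u s0 u01; rewrite /= -[in RHS]mulrA -fgSU// -(mulrA a) mulrCA.
- by rewrite !cintegralZl// -!mulrA !Rea.
Qed.

End ComplexTonelli.



(** * Lower bounds for Gamma, and the Beta identity *)

Section GammaBeta.
Context {R : realType}.
Local Notation mu := (@lebesgue_measure R).
Local Notation R0y := (`]0, +oo[%classic : set R).
Local Notation R01 := (`]0, 1[%classic : set R).
Implicit Types (p q z b : R[i]) (a s T x : R).

Definition cgammaf z x : R[i] := rpow x (z - 1) * (expR (- x))%:C.

Definition cbetaf p q x : R[i] := rpow x (p - 1) * rpow (1 - x) (q - 1).

Definition Beta p q := cintegral R01 (cbetaf p q).

Definition rGamma a : R := Rintegral mu R0y (gammaf a).

Lemma Re_subr1 z : complex.Re (z - 1) = complex.Re z - 1.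
Proof. by rewrite Re_add Re_opp. Qed.

Lemma cabs_cgammaf z x : 0 < x -> cabs (cgammaf z x) = gammaf (complex.Re z) x.
Proof.
by move=> x0; rewrite cabsM cabs_rpow// cabsR ger0_norm ?expR_ge0// Re_subr1.
Qed.

Lemma cmeasurable_cgammaf z (D : set R) : cmeasurable D (cgammaf z).
Proof.
apply: cmeasurableM.
  by apply: cmeasurable_rpow; exact: measurable_id.
apply: cmeasurable_real; apply: (measurableT_comp (@measurable_expR R)).
exact: measurable_funTS.
Qed.

Lemma cintegrable_cgammaf z : 0 < complex.Re z -> cintegrable R0y (cgammaf z).
Proof.
move=> z0; apply: (@cintegrable_le _ _ _ _ (gammaf (complex.Re z))) => //.
- exact: cmeasurable_cgammaf.
- exact: integrable_gammaf.
- by move=> x; rewrite /= in_itv /= andbT => x0; rewrite cabs_cgammaf.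
Qed.

Lemma GammaE z : 0 < complex.Re z -> Gamma z = cintegral R0y (cgammaf z).
Proof.
move=> z0; rewrite /Gamma z0 big_ord0 divr1 addr0.
apply: eq_cintegral => x; rewrite inE /= in_itv /= andbT => x0.
by rewrite rpowE.
Qed.

Lemma Gamma_real a : 0 < a -> Gamma a%:C = (rGamma a)%:C.
Proof.
move=> a0; rewrite GammaE// /cintegral /rGamma.
have e x : x \in R0y -> cgammaf a%:C x = (gammaf a x)%:C.
  rewrite inE /= in_itv /= andbT => x0.
  by rewrite /cgammaf -rmorphB rpow_real// -rmorphM.
rewrite (_ : (Rintegral _ _ _)%:C = Rintegral mu R0y (gammaf a) +i* 0)//.
congr (_ +i* _); first by apply: eq_Rintegral => x xR; rewrite (e _ xR).
rewrite (_ : Rintegral _ _ _ = Rintegral mu R0y (fun=> 0)); last first.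
  by apply: eq_Rintegral => x xR; rewrite (e _ xR).
by rewrite /Rintegral integral0.
Qed.

Lemma rGamma_ge0 a : 0 <= rGamma a.
Proof. by apply: Rintegral_ge0 => x _; exact: gammaf_ge0. Qed.

(** The integrand is nonnegative and the interval [T, T + 1] has length 1. *)
Lemma rGamma_ge a T (c : R) : 0 < a -> 0 < T -> 0 <= c ->
  (forall x, T <= x <= T + 1 -> c <= gammaf a x) -> c <= rGamma a.
Proof.
move=> a0 T0 c0 h; rewrite -lee_fin /rGamma /Rintegral fineK; last first.
  by apply: integrable_fin_num => //; exact: integrable_gammaf.
have mg D : measurable_fun D (fun x : R => (gammaf a x)%:E).
  by apply/measurable_EFinP; exact: measurable_gammaf.
apply: (@le_trans _ _ (\int[mu]_(x in `[T, (T + 1)%R]) (gammaf a x)%:E)%E).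
  apply: (@le_trans _ _ (\int[mu]_(x in `[T, (T + 1)%R]) (cst c%:E x))%E).
    rewrite integral_cst//= lebesgue_measure_itv /= lte_fin ltrDl ltr01.
    by rewrite -EFinB addrAC subrr add0r mule1.
  apply: ge0_le_integral => //.
  exact: mg.
apply: ge0_subset_integral => //.
- exact: mg.
- by move=> x _; rewrite lee_fin gammaf_ge0.
- move=> x; rewrite /= !in_itv /= andbT => /andP[Tx _].
  exact: lt_le_trans Tx.
Qed.

Lemma rGamma_gt0 a : 0 < a -> 0 < rGamma a.
Proof.
(* On [1, 2] one has x^(a-1) >= x^(-1) >= 1/2 and e^(-x) >= e^(-2). *)
move=> a0; apply: (@lt_le_trans _ _ (2^-1 * expR (- 2))).
  by rewrite mulr_gt0 ?invr_gt0 ?expR_gt0.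
apply: (@rGamma_ge _ 1) => //.
move=> x /andP[x1 x2]; have x0 : 0 < x by exact: lt_le_trans x1.
apply: ler_pM; rewrite ?invr_ge0 ?expR_ge0//.
  apply: (@le_trans _ _ (x `^ (-1))).
    by rewrite powR_inv1 ?(ltW x0)// lef_pV2// posrE.
  by apply: ler_powR => //; rewrite -[leLHS]add0r lerD2r ltW.
by rewrite ler_expR lerN2.
Qed.

(** [T] stays free: a large [T] makes Gamma outgrow any prescribed geometric sequence. *)
Lemma rGamma_ge_powR T s : 1 <= T -> 1 <= s ->
  T `^ (s - 1) * expR (- (T + 1)) <= rGamma s.
Proof.
move=> T1 s1; have T0 : 0 < T by exact: lt_le_trans T1.
apply: (@rGamma_ge _ T) => //; first exact: lt_le_trans s1.
  by rewrite mulr_ge0 ?powR_ge0 ?expR_ge0.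
move=> x /andP[Tx xT]; apply: ler_pM; rewrite ?powR_ge0 ?expR_ge0//.
  apply: ge0_ler_powR; rewrite ?subr_ge0// ?nnegrE ?(ltW T0)//.
  exact: le_trans (ltW T0) Tx.
by rewrite ler_expR lerN2.
Qed.

Lemma cmeasurable_cbetaf p q (D : set R) : cmeasurable D (cbetaf p q).
Proof.
apply: cmeasurableM; apply: cmeasurable_rpow; first exact: measurable_id.
by apply: measurable_funB.
Qed.

(** Here [S] is [cgammaf (p + q)] and [U] is [cbetaf p q]: the Jacobian s raises the exponent (p -
    1) + (q - 1) of s to p + q - 1, and the two exponentials multiply to e^(-s). *)
Lemma Beta_Gamma p q : 0 < complex.Re p -> 0 < complex.Re q ->
  cintegrable R01 (cbetaf p q) /\ Gamma p * Gamma q = Gamma (p + q) * Beta p q.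
Proof.
move=> p0 q0; have pq0 : 0 < complex.Re (p + q) by rewrite Re_add addr_gt0.
rewrite !GammaE//; apply: cintegral_simplex.
- exact: cmeasurable_cgammaf.
- exact: cmeasurable_cgammaf.
- exact: cmeasurable_cbetaf.
- exact: cintegrable_cgammaf.
- exact: cintegrable_cgammaf.
- exact: cintegrable_cgammaf.
- rewrite (_ : Rintegral _ _ _ = rGamma (complex.Re (p + q))) ?rGamma_gt0//.
  apply: eq_Rintegral => x; rewrite inE /= in_itv /= andbT => x0.
  by rewrite cabs_cgammaf.
- move=> s u s0 /andP[u0 u1]; have u1' : 0 < 1 - u by rewrite subr_gt0.
  rewrite /cgammaf /cbetaf !rpowM// -(rpow1 s0).
  have -> : p + q - 1 = 1 + (p - 1) + (q - 1) by ring.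
  rewrite !rpowD.
  have -> : expR (- s) = expR (- (s * u)) * expR (- (s * (1 - u))).
    by rewrite -expRD; congr expR; ring.
  rewrite rmorphM /=; ring.
Qed.

Lemma cintegrable_cbetaf p q : 0 < complex.Re p -> 0 < complex.Re q ->
  cintegrable R01 (cbetaf p q).
Proof. by move=> p0 q0; have [] := Beta_Gamma p0 q0. Qed.

Lemma Gamma_Beta p q : 0 < complex.Re p -> 0 < complex.Re q ->
  Gamma p * Gamma q = Gamma (p + q) * Beta p q.
Proof. by move=> p0 q0; have [] := Beta_Gamma p0 q0. Qed.

End GammaBeta.



(** * Gamma has no zeros in the right half-plane *)

Section GammaNonvanishing.
Context {R : realType}.
Local Notation mu := (@lebesgue_measure R).
Local Notation R0y := (`]0, +oo[%classic : set R).
Local Notation R01 := (`]0, 1[%classic : set R).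
Implicit Types (p q z b : R[i]) (a s T x : R).

Lemma cbetafD1 p q x : 0 < x < 1 ->
  cbetaf p q x = cbetaf (p + 1) q x + cbetaf p (q + 1) x.
Proof.
move=> /andP[x0 x1]; have x1' : 0 < 1 - x by rewrite subr_gt0.
have -> : cbetaf (p + 1) q x = x%:C * cbetaf p q x.
  by rewrite /cbetaf (addrAC p 1) (rpowD x (p - 1)) (rpow1 x0) mulrAC mulrC.
have -> : cbetaf p (q + 1) x = (1 - x)%:C * cbetaf p q x.
  by rewrite /cbetaf (addrAC q 1) (rpowD _ (q - 1)) (rpow1 x1') mulrA mulrC.
by rewrite -mulrDl -rmorphD addrC subrK mul1r.
Qed.

Lemma BetaD1 p q : 0 < complex.Re p -> 0 < complex.Re q ->
  Beta p q = Beta (p + 1) q + Beta p (q + 1).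
Proof.
move=> p0 q0.
have p1 : 0 < complex.Re (p + 1) by rewrite Re_add addr_gt0.
have q1 : 0 < complex.Re (q + 1) by rewrite Re_add addr_gt0.
have [i1 j1] := cintegrable_cbetaf p1 q0.
have [i2 j2] := cintegrable_cbetaf p0 q1.
rewrite /Beta (eq_cintegral
  (g := fun x => cbetaf (p + 1) q x + cbetaf p (q + 1) x)); last first.
  by move=> x; rewrite inE /= in_itv /= => /cbetafD1 ->.
apply: complex_ext; rewrite ?Re_add ?Im_add /cintegral /=.
  by rewrite -RintegralD//; apply: eq_Rintegral => x _; rewrite Re_add.
by rewrite -RintegralD//; apply: eq_Rintegral => x _; rewrite Im_add.
Qed.

(* Adding the Beta identities for (z + 1, 1) and (z, 2) gives
   Gamma (z + 1) Gamma 1 + Gamma z Gamma 2 = Beta z 1 * Gamma (z + 2). *)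
Lemma Gamma_eq0D1 z : 0 < complex.Re z -> Gamma z = 0 -> Gamma (z + 1) = 0.
Proof.
move=> z0 Gz; have one0 : 0 < complex.Re (1 : R[i]) by [].
have z1 : 0 < complex.Re (z + 1) by rewrite Re_add addr_gt0.
have two0 : 0 < complex.Re (1 + 1 : R[i]) by rewrite Re_add addr_gt0.
have := Gamma_Beta z0 one0; rewrite Gz mul0r => /esym/eqP.
rewrite mulf_eq0 => /orP[/eqP//|/eqP B0].
have e1 := Gamma_Beta z1 one0; have e2 := Gamma_Beta z0 two0.
have : Gamma (z + 1) * Gamma 1 + Gamma z * Gamma (1 + 1) = 0.
  by rewrite e1 e2 (addrA z) -mulrDr -BetaD1// B0 mulr0.
rewrite Gz mul0r addr0 => /eqP; rewrite mulf_eq0 => /orP[/eqP//|].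
by rewrite (Gamma_real ltr01) real_complex_eq0 gt_eqF// rGamma_gt0.
Qed.

Lemma Gamma_eq0_half z : 0 < complex.Re z -> Gamma z = 0 -> Gamma (z / 2) = 0.
Proof.
move=> z0 Gz; have z20 : 0 < complex.Re (z / 2).
  have -> : z / 2 = z * (2^-1)%:C by rewrite fmorphV rmorph_nat.
  by rewrite Re_mulR mulr_gt0.
have := Gamma_Beta z20 z20.
have -> : z / 2 + z / 2 = z by field.
by rewrite Gz mul0r => /eqP; rewrite mulf_eq0 orbb => /eqP.
Qed.

(** Continuity at 1 is only needed along this sequence and for the real part, whose limit [rGamma 1]
    is positive. *)
Lemma cvg_Gamma1 z : 0 < complex.Re z ->
  (fun m : nat => complex.Re (Gamma (1 + z * (2^-1 ^+ m)%:C))) @ \oo --> rGamma 1.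
Proof.
move=> z0.
have h2 m : 0 < (2^-1 : R) ^+ m <= 1.
  by rewrite exprn_gt0//= exprn_ile1// invf_le1// ler1n.
have pos m : 0 < complex.Re (1 + z * (2^-1 ^+ m)%:C).
  by rewrite Re_add Re_mulR addr_gt0// mulr_gt0//.
under eq_fun do rewrite GammaE//.
pose f m x := complex.Re (cgammaf (1 + z * (2^-1 ^+ m)%:C) x).
pose a := complex.Re z; pose b := complex.Im z.
have fE m x : f m x =
    expR (2^-1 ^+ m * (a * ln x)) * cos (2^-1 ^+ m * (b * ln x)) * expR (- x).
  rewrite /f /cgammaf addrC addKr Re_mulR; congr (_ * _).
  rewrite /rpow Re_cexp !Re_mulR !Im_mulR.
  by congr (expR _ * cos _); rewrite mulrAC mulrC.
have m0 : measurable R0y by exact: measurable_itv.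
(* With 0 < h <= 1, the power x^(a h) is at most x^a for x >= 1 and at most 1 for x <= 1; the
   majorant adds the two cases. *)
have [|||||_ _] := @dominated_convergence _ _ _ mu R0y m0
  (fun m x => (f m x)%:E) (fun x => (gammaf 1 x)%:E)
  (fun x => (gammaf 1 x + gammaf (a + 1) x)%:E).
- move=> m; apply/measurable_EFinP.
  by have [] := cmeasurable_cgammaf (1 + z * (2^-1 ^+ m)%:C) R0y.
- by apply/measurable_EFinP; exact: measurable_gammaf.
- apply: aeW => x _; apply: cvg_EFin; first exact: nearW.
  have -> : gammaf 1 x = expR (0 * (a * ln x)) * cos (0 * (b * ln x)) * expR (- x).
    by rewrite /gammaf subrr powRr0 !mul0r expR0 cos0 mulr1.
  have c2 : (fun m : nat => (2^-1 : R) ^+ m) @ \oo --> (0 : R).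
    by apply: cvg_expr; rewrite ger0_norm// invf_lt1// ltr1n.
  rewrite /comp /=; under eq_fun do rewrite fE.
  apply: cvgM; last exact: cvg_cst.
  apply: cvgM.
    apply: continuous_cvg; first exact: continuous_expR.
    by apply: cvgM c2 _; exact: cvg_cst.
  apply: continuous_cvg; first exact: continuous_cos.
  by apply: cvgM c2 _; exact: cvg_cst.
- apply: integrable_EFinD => //; apply: integrable_gammaf => //.
  by rewrite addr_gt0.
- apply: aeW => x m; rewrite /= in_itv /= andbT => x0; rewrite lee_fin.
  apply: le_trans (Re_le_cabs _) _; rewrite cabs_cgammaf// /gammaf.
  rewrite -mulrDl ler_wpM2r ?expR_ge0//.
  have -> : complex.Re (1 + z * (2^-1 ^+ m)%:C) - 1 = a * 2^-1 ^+ m.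
    by rewrite Re_add Re_mulR addrC addKr.
  rewrite subrr powRr0 addrK; have /andP[h20 h21] := h2 m.
  have [x1|/ltW x1] := leP 1 x.
    apply: (@le_trans _ _ (x `^ a)); last by rewrite lerDr.
    by apply: ler_powR => //; rewrite ler_piMr// ltW.
  apply: (@le_trans _ _ 1); last by rewrite lerDl powR_ge0.
  rewrite -[leRHS](powRr0 x); apply: ger_powR; first by rewrite x0.
  by rewrite mulr_ge0// ltW.
move=> cl.
have cl' : (fun m => \int[mu]_(x in R0y) (f m x)%:E)%E @ \oo --> (rGamma 1)%:E.
  rewrite /rGamma /Rintegral fineK; first exact: cl.
  by apply: integrable_fin_num => //; exact: integrable_gammaf.
exact: fine_cvg cl'.
Qed.

Lemma Gamma_neq0 z : 0 < complex.Re z -> Gamma z != 0.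
Proof.
move=> z0; apply/eqP => Gz.
have pos m : 0 < complex.Re (z * (2^-1 ^+ m)%:C).
  by rewrite Re_mulR mulr_gt0// exprn_gt0.
have G0 m : Gamma (z * (2^-1 ^+ m)%:C) = 0.
  elim: m => [|m IH]; first by rewrite expr0 mulr1.
  have -> : z * (2^-1 ^+ m.+1)%:C = z * (2^-1 ^+ m)%:C / 2.
    by rewrite exprSr rmorphM fmorphV rmorph_nat mulrA.
  exact: Gamma_eq0_half.
have := cvg_Gamma1 z0.
have -> : (fun m : nat => complex.Re (Gamma (1 + z * (2^-1 ^+ m)%:C))) = fun=> 0.
  by apply/funext => m; rewrite addrC Gamma_eq0D1.
move=> /(cvg_lim (@norm_hausdorff _ _)); rewrite lim_cst// => h.
by have := @rGamma_gt0 R 1 ltr01; rewrite -h ltxx.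
Qed.

End GammaNonvanishing.



(** * Bounds for quotients of Gamma values *)

Section GammaRatio.
Context {R : realType}.
Local Notation mu := (@lebesgue_measure R).
Local Notation R01 := (`]0, 1[%classic : set R).
Implicit Types (b z : R[i]) (a s v T X : R).

Lemma cabs_cintegral_le (D : set R) (mD : measurable D) (f : R -> R[i])
    (g : R -> R) : cintegrable D f -> mu.-integrable D (EFin \o g) ->
  (forall x, D x -> cabs (f x) <= g x) ->
  cabs (cintegral D f) <= 2 * Rintegral mu D g.
Proof.
move=> [f1 f2] ig fg; rewrite mulr_natl mulr2n.
apply: le_trans (cabs_le _) _; apply: lerD => /=.
  apply: (@le_trans _ _ (Rintegral mu D (fun x => `|complex.Re (f x)|))).
    exact: le_normr_Rintegral.
  apply: le_Rintegral => //; first exact: integrable_norm.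
  by move=> x Dx; exact: le_trans (Re_le_cabs _) (fg _ Dx).
apply: (@le_trans _ _ (Rintegral mu D (fun x => `|complex.Im (f x)|))).
    exact: le_normr_Rintegral.
apply: le_Rintegral => //; first exact: integrable_norm.
by move=> x Dx; exact: le_trans (Im_le_cabs _) (fg _ Dx).
Qed.

Lemma Gamma_ratio b s : 0 < complex.Re b -> 0 < s ->
  Gamma b / Gamma (b + s%:C) = Beta b s%:C / (rGamma s)%:C.
Proof.
move=> b0 s0; have bs0 : 0 < complex.Re (b + s%:C) by rewrite Re_add addr_gt0.
have G1 := Gamma_neq0 bs0; have G2 : (rGamma s)%:C != 0 :> R[i].
  by rewrite real_complex_eq0 gt_eqF// rGamma_gt0.
have sC : 0 < complex.Re (s%:C : R[i]) by [].
have := Gamma_Beta b0 sC; rewrite (Gamma_real s0) => GB.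
by apply/eqP; rewrite eqr_div// GB mulrC.
Qed.

Lemma cabs_cbetaf b z x : 0 < x < 1 -> cabs (cbetaf b z x) =
  x `^ (complex.Re b - 1) * (1 - x) `^ (complex.Re z - 1).
Proof.
move=> /andP[x0 x1].
by rewrite cabsM !cabs_rpow ?subr_gt0// !Re_subr1.
Qed.

(** On ]0, 1[ larger exponents give smaller powers, so the Beta integrand with parameters [a] and
    [v] dominates all the others. [K] depends on neither [b] nor [s], which later makes the bounds
    uniform in r. *)
Lemma Gamma_ratio_le a v : 0 < a -> 0 < v -> exists2 K, 0 <= K &
  forall b s, a <= complex.Re b -> v <= s ->
    cabs (Gamma b / Gamma (b + s%:C)) <= K / rGamma s.
Proof.
move=> a0 v0; pose g := cabs \o cbetaf a%:C v%:C.
exists (2 * Rintegral mu R01 g).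
  by rewrite mulr_ge0//; apply: Rintegral_ge0 => x _; exact: cabs_ge0.
move=> b s ab vs; have b0 := lt_le_trans a0 ab; have s0 := lt_le_trans v0 vs.
rewrite Gamma_ratio// cabsM cabsV cabsR (ger0_norm (rGamma_ge0 _)).
rewrite ler_wpM2r ?invr_ge0 ?rGamma_ge0//.
have m1 : measurable R01 by exact: measurable_itv.
apply: cabs_cintegral_le => //.
- exact: cintegrable_cbetaf.
- by apply: cintegrable_cabs => //; exact: cintegrable_cbetaf.
move=> x; rewrite /= in_itv /= => x01.
rewrite /g /= !cabs_cbetaf//= ; case/andP : x01 => x0 x1.
apply: ler_pM; rewrite ?powR_ge0//.
  by apply: ger_powR; rewrite ?x0 ?(ltW x1)// lerD2r.
by apply: ger_powR; rewrite ?subr_gt0 ?x1 ?gerBl ?(ltW x0)//= lerD2r.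
Qed.

Lemma cvg_series_rGamma v X : 0 < v -> 0 <= X ->
  cvgn (series (fun n => X ^+ n / rGamma (v * n%:R))).
Proof.
(* Gamma s >= T^(s-1) e^(-(T+1)) with T chosen so that T^v = 2 X + 1 > 2 X. *)
move=> v0 X0; pose Y := 2 * X + 1.
have Y1 : 1 <= Y by rewrite /Y lerDr mulr_ge0.
have Y0 : 0 < Y by exact: lt_le_trans Y1.
pose T := Y `^ v^-1.
have T1 : 1 <= T by rewrite -(powRr0 Y) ler_powR// invr_ge0 ltW.
have T0 : 0 < T by exact: lt_le_trans T1.
(* Dropping the first m terms brings the argument of Gamma into the range s >= 1 of
   [rGamma_ge_powR]. *)
have [m vm] : exists m : nat, 1 <= v * m%:R.
  exists (Num.truncn v^-1).+1; rewrite -ler_pdivrMl// mulr1.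
  exact/ltW/truncnS_gt.
apply: (@cvg_series_shift _ _ m).
(* The constant inverts the factors 1 / T and e^(-(T+1)) of the lower bound; X <= Y / 2 gives the
   ratio, and X^m <= Y^m absorbs the shift. *)
apply: (@cvg_series_geometric_le _ _ (T * expR (T + 1)) 2^-1).
  by rewrite invr_ge0 ler0n invf_lt1// ltr1n.
move=> n; rewrite ger0_norm; last first.
  by rewrite mulr_ge0 ?exprn_ge0// invr_ge0 rGamma_ge0.
have vn : 1 <= v * (n + m)%:R.
  by apply: le_trans vm _; rewrite ler_pM2l// ler_nat leq_addl.
have G0 : 0 < rGamma (v * (n + m)%:R).
  by apply: rGamma_gt0; exact: lt_le_trans vn.
have TE : T `^ (v * (n + m)%:R - 1) = Y ^+ (n + m) / T.
  have c : (v * (n + m)%:R == 1) ==> (T != 0) by rewrite (gt_eqF T0) implybT.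
  rewrite (powRB c) (powRr1 (ltW T0)); congr (_ / _).
  rewrite /T -powRrM mulrA mulVf ?gt_eqF// mul1r powR_mulrn//.
  exact: ltW.
have := rGamma_ge_powR T1 vn; rewrite TE => h.
rewrite ler_pdivrMr//.
apply: (@le_trans _ _ (T * expR (T + 1) * 2^-1 ^+ n *
    (Y ^+ (n + m) / T * expR (- (T + 1))))); last first.
  by rewrite ler_wpM2l// !mulr_ge0 ?expR_ge0 ?exprn_ge0 ?invr_ge0// ltW.
have -> : T * expR (T + 1) * 2^-1 ^+ n *
    (Y ^+ (n + m) / T * expR (- (T + 1))) = 2^-1 ^+ n * Y ^+ (n + m).
  by rewrite expRN; field; rewrite !gt_eqF ?expR_gt0.
rewrite !exprD mulrA -exprMn.
have XY : X <= Y by rewrite /Y; lra.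
have XY2 : X <= 2^-1 * Y by rewrite /Y; lra.
apply: ler_pM; rewrite ?exprn_ge0//.
  by apply: lerXn2r; rewrite ?nnegrE// (le_trans X0).
by apply: lerXn2r; rewrite ?nnegrE// (le_trans X0).
Qed.

End GammaRatio.



(** * Majorants for the Mittag-Leffler and k-Struve series *)

Section Coefficients.
Context {R : realType}.
Implicit Types (b q e z X : R[i]) (a v K x : R).

(** The separate summand 1 at n = 0 covers Gamma b / Gamma b, where the ratio bound would need s >
    0. Of the other summand only the sign matters there. *)
Definition ml_majorant K v x (n : nat) : R :=
  (n == 0%N)%:R + K * (x ^+ n / rGamma (v * n%:R)).

Lemma ml_majorant_ge0 K v x n : 0 <= K -> 0 <= x -> 0 <= ml_majorant K v x n.
Proof.
move=> K0 x0; rewrite addr_ge0// mulr_ge0// divr_ge0 ?exprn_ge0//.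
exact: rGamma_ge0.
Qed.

Lemma cvg_ml_majorant K v x : 0 < v -> 0 <= x ->
  cvgn (series (ml_majorant K v x)).
Proof.
move=> v0 x0; have c1 : cvgn (series (fun n => (n == 0%N)%:R : R)).
  apply: (@cvg_series_shift _ _ 1); apply/cvg_ex; exists 0.
  rewrite (_ : series _ = fun=> 0); first exact: cvg_cst.
  by apply/funext => n; rewrite /series /= big1// => i _; rewrite addn1.
have c2 : cvgn (series (K *: (fun n => x ^+ n / rGamma (v * n%:R)))).
  exact: is_cvg_seriesZ (cvg_series_rGamma _ _).
exact: is_cvg_seriesD c1 c2.
Qed.

Lemma mittag_leffler_term_le a v : 0 < a -> 0 < v -> exists2 K, 0 <= K &
  forall b X n, a <= complex.Re b ->
    cabs (Gamma b * mittag_leffler_term v%:C b X n) <= ml_majorant K v (cabs X) n.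
Proof.
move=> a0 v0; have [K K0 hK] := Gamma_ratio_le a0 v0.
exists K => // b X [|n] ab.
  rewrite /mittag_leffler_term expr0 mulr0 add0r div1r.
  rewrite mulfV ?Gamma_neq0 ?(lt_le_trans a0 ab)// (cabsR 1) normr1 lerDl.
  by rewrite mulr_ge0// mulr_ge0 ?invr_ge0 ?rGamma_ge0.
rewrite /ml_majorant add0r /mittag_leffler_term mulrCA cabsM cabsX mulrCA.
rewrite ler_wpM2l ?exprn_ge0 ?cabs_ge0// addrC.
have -> : v%:C * n.+1%:R = (v * n.+1%:R)%:C :> R[i] by rewrite natC rmorphM.
by apply: hK => //; rewrite ler_peMr ?(ltW v0)// ler1n.
Qed.

Lemma cvg_csum_mittag_leffler v b X : 0 < v -> 0 < complex.Re b ->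
  cvg_csum (mittag_leffler_term v%:C b X).
Proof.
move=> v0 b0; have [K K0 hK] := mittag_leffler_term_le b0 v0.
have c1 : cvg_csum (fun n => Gamma b * mittag_leffler_term v%:C b X n).
  have h := @cvg_ml_majorant K v _ v0 (cabs_ge0 X).
  exact: cvg_csum_le (fun n => hK b X n (lexx _)) h.
have [+ _] := csumZ (Gamma b)^-1 c1.
congr cvg_csum; apply/funext => n.
by rewrite mulKf// Gamma_neq0.
Qed.

Lemma rGamma_ge_expN2 a : 1 <= a -> expR (- 2) <= rGamma a.
Proof.
by move=> /(rGamma_ge_powR (lexx 1)); rewrite powR1 mul1r.
Qed.

(** [z] is arbitrary, so finitely many r + z may lie in the left half-plane. Past them, the ratio
    bound compares 1 / Gamma (r + z) with the reciprocal of a real Gamma value, which already gives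
    convergence; the factor 1 / Gamma (r + 3/2) is merely bounded by e^2. *)
Lemma cvg_series_struve_coef e q z :
  cvgn (series (fun r => cabs (e * (q ^+ r /
    (Gamma (r%:R + z) * Gamma (r%:R + 3 / 2)))))).
Proof.
have [m zm] : exists m : nat, 1 <= complex.Re (m%:R + z).
  exists (Num.truncn (1 - complex.Re z)).+1.
  by rewrite Re_add natC /= -lerBlDr; exact/ltW/truncnS_gt.
have [K K0 hK] := Gamma_ratio_le (@ltr01 R) (@ltr01 R).
pose x := cabs q; have x0 : 0 <= x by exact: cabs_ge0.
pose G := cabs (Gamma (m%:R + z)).
have G0 : 0 < G by rewrite cabs_gt0 Gamma_neq0// (lt_le_trans _ zm).
pose M := cabs e * x ^+ m * (K / G) * expR 2.
(* One more than m: the increment s = n + 1 in the ratio bound is then at least 1 for all n. *)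
apply: (@cvg_series_shift _ _ m.+1).
have c1 : cvgn (series (fun n => x ^+ n.+1 / rGamma (1 * n.+1%:R))).
  have := cvg_series_S (@cvg_series_rGamma R 1 x ltr01 x0).
  by move=> h; apply/cvg_ex; eexists; exact: h.
have c2 : cvgn (series (M *: (fun n => x ^+ n.+1 / rGamma (1 * n.+1%:R)))).
  exact: is_cvg_seriesZ.
apply: cvg_series_dominated c2 => n; rewrite ger0_norm ?cabs_ge0//.
have e1 : (n + m.+1)%:R + z = m%:R + z + (n.+1%:R)%:C :> R[i].
  by rewrite -natC addrAC -natrD addnS -addSn addnC.
have e2 : (n + m.+1)%:R + 3 / 2 = ((n + m.+1)%:R + 3 / 2)%:C :> R[i].
  by move: (n + m.+1)%N => N; rewrite rmorphD rmorphM fmorphV !rmorph_nat.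
have p32 : 1 <= (n + m.+1)%:R + 3 / 2 :> R.
  have : 0 <= (n + m.+1)%:R :> R by exact: ler0n.
  lra.
have n1 : 1 <= n.+1%:R :> R by rewrite ler1n.
have p1 := hK _ _ zm n1.
have q1 : (rGamma ((n + m.+1)%:R + 3 / 2))^-1 <= expR 2 :> R.
  rewrite -[expR 2]invrK -expRN lef_pV2 ?posrE ?expR_gt0//.
    exact: rGamma_ge_expN2.
  by apply: rGamma_gt0; exact: lt_le_trans p32.
rewrite e1 e2 Gamma_real ?(lt_le_trans _ p32)//.
rewrite invfM !cabsM cabsX !cabsV cabsR (ger0_norm (rGamma_ge0 _)) -/x.
have p2 : (cabs (Gamma (m%:R + z + (n.+1%:R)%:C)))^-1 <=
    K / G * (rGamma n.+1%:R)^-1.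
  by rewrite mulrAC ler_pdivlMr// mulrC -cabsV -cabsM.
rewrite [leRHS](_ : _ = cabs e * (x ^+ (n + m.+1) *
   (K / G * (rGamma n.+1%:R)^-1 * expR 2))); last first.
  rewrite -[LHS]/(M * (x ^+ n.+1 / rGamma (1 * n.+1%:R))) /M mul1r -addSnnS exprD.
  ring.
rewrite ler_wpM2l ?cabs_ge0// ler_wpM2l ?exprn_ge0//.
by apply: ler_pM => //; rewrite invr_ge0 ?cabs_ge0 ?rGamma_ge0.
Qed.

End Coefficients.



(** * The kinetic equation *)

Section KineticSolution.
Context {R : realType}.
Local Notation mu := (@lebesgue_measure R).
Local Notation R01 := (`]0, 1[%classic : set R).
Variables (k d v : R) (l c : R[i]).
Hypotheses (hk : 0 < k) (hd : 0 < d) (hv : 0 < v).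
Hypothesis hint : - 1 < v * (complex.Re l / k + 1).
Implicit Types (t X : R[i]) (r n : nat) (y : R).

Let D : R[i] := (d `^ v)%:C.
Let X t : R[i] := - (D * cpow t v%:C).
Let b r := solution_index k v l r.
Let S t r := kstruve_coef k l c r * cpow (D / 2) (2 * r%:R + l / k%:C + 1)
  * cpow t (2 * v%:C * r%:R + l / k%:C * v%:C + v%:C).

Let v_neq0 : v%:C != 0 :> R[i].
Proof. by rewrite real_complex_eq0 gt_eqF. Qed.

Let k_neq0 : k%:C != 0 :> R[i].
Proof. by rewrite real_complex_eq0 gt_eqF. Qed.

Let D2E : D / 2 = (d `^ v / 2)%:C.
Proof. by rewrite /D rmorphM fmorphV rmorph_nat. Qed.

Let D2_gt0 : 0 < d `^ v / 2.
Proof. by rewrite divr_gt0// powR_gt0. Qed.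

Let D2_neq0 : D / 2 != 0.
Proof. by rewrite D2E real_complex_eq0 gt_eqF. Qed.

(** This is Re b_0, the least of the Re b_r; [hint] says that it is positive. *)
Let a0 := v * (complex.Re l / k + 1) + 1.

Let a0_gt0 : 0 < a0.
Proof. by rewrite /a0 -ltrBlDr sub0r. Qed.

Lemma Re_solution_index r : complex.Re (b r) = a0 + 2 * r%:R * v.
Proof.
have e : b r = ((2 * r%:R)%:C * v%:C + (l * k^-1%:C + 1) * v%:C + 1).
  rewrite /b /solution_index rmorphM !rmorph_nat fmorphV; ring.
rewrite e !Re_add !Re_mulR Re_add Re_mulR /= /a0; ring.
Qed.

Let Re_b r : a0 <= complex.Re (b r).
Proof. by rewrite Re_solution_index lerDl !mulr_ge0// ltW. Qed.

Let b_gt0 r : 0 < complex.Re (b r).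
Proof. exact: lt_le_trans (Re_b r). Qed.

Let exponentE r : 2 * v%:C * r%:R + l / k%:C * v%:C + v%:C = b r - 1.
Proof. by rewrite /b /solution_index; ring. Qed.

Lemma cpowD_natM t u w n : t != 0 ->
  cpow t (u + w * n%:R) = cpow t u * cpow t w ^+ n.
Proof. by move=> t0; rewrite cpowD// cpow_natM. Qed.

(** The argument [v * carg t] amounts to choosing ln (d^v / 2) + v log t as the logarithm of d^v t^v
    / 2, so its powers factor without branch correction. *)
Lemma kstruve_termE t r : t != 0 ->
  kstruve_term k l c (D * cpow t v%:C) (v * carg t) r = S t r.
Proof.
move=> t0; rewrite /kstruve_term /S -[RHS](mulrA (kstruve_coef k l c r)).
congr (_ * _).
have x0 : D * cpow t v%:C / 2 != 0.
  by rewrite mulrAC mulf_neq0// cpow_neq0.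
rewrite (cpow_arg_neq0 _ _ x0).
have -> : cabs (D * cpow t v%:C / 2) = d `^ v / 2 * cabs t `^ v.
  rewrite mulrAC cabsM D2E cabsR ger0_norm ?(ltW D2_gt0)//; congr (_ * _).
  rewrite -[v%:C]add0r cabs_cpow// /cpow cpow_arg_neq0// mul0r cexp0.
  by rewrite (cabsR 1) normr1 mul1r.
rewrite D2E rpowE// /rpow /cpow (cpow_arg_neq0 _ _ t0) -cexpD; congr cexp.
have ct : 0 < cabs t by rewrite cabs_gt0.
rewrite lnM ?posrE ?powR_gt0// ln_powR.
have -> : (ln (d `^ v / 2) + v * ln (cabs t)) +i* (v * carg t) =
   (ln (d `^ v / 2))%:C + v%:C * (ln (cabs t) +i* carg t).
  by apply: complex_ext; rewrite ?Re_add ?Im_add ?Re_mul ?Im_mul /=; ring.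
ring.
Qed.

(** Each step in r adds 2, 2 v and 1 to the exponents of [D / 2], [t] and [k] (the last from the
    k-Gamma function). These increments and - c make up [q], the values at r = 0 make up [e]. *)
Lemma kstruve_term_power t : t != 0 -> exists e q, forall r,
  S t r = e * (q ^+ r / (Gamma (r%:R + (l / k%:C + 3 / 2)) * Gamma (r%:R + 3 / 2))).
Proof.
move=> t0.
exists (cpow (D / 2) (l / k%:C + 1) * cpow t (l / k%:C * v%:C + v%:C)
  / cpow k%:C (l / k%:C + 2^-1)).
exists (- c * cpow (D / 2) 2 * cpow t (2 * v%:C) / cpow k%:C 1) => r.
rewrite /S /kstruve_coef /kGamma.
have -> : (r%:R * k%:C + l + 3 * k%:C / 2) / k%:C = r%:R + (l / k%:C + 3 / 2).
  by field.
have -> : r%:R + (l / k%:C + 3 / 2) - 1 = l / k%:C + 2^-1 + 1 * r%:R by field.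
have -> : 2 * r%:R + l / k%:C + 1 = l / k%:C + 1 + 2 * r%:R by ring.
have -> : 2 * v%:C * r%:R + l / k%:C * v%:C + v%:C =
  l / k%:C * v%:C + v%:C + 2 * v%:C * r%:R by ring.
move: (Gamma (r%:R + (l / k%:C + 3 / 2))) (Gamma (r%:R + 3 / 2)) => G1 G2.
rewrite !cpowD_natM// expr_div_n !exprMn !invfM -!exprVn.
ring.
Qed.

Lemma cvg_series_kstruve_term t : t != 0 ->
  cvgn (series (fun r => cabs (S t r))).
Proof.
move=> t0; have [e [q E]] := kstruve_term_power t0.
by under eq_fun do rewrite E; exact: cvg_series_struve_coef.
Qed.

Lemma mittag_leffler_argument_scale t y : t != 0 -> 0 < y ->
  X (y%:C * t) = X t * rpow y v%:C.
Proof.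
by move=> t0 y0; rewrite /X cpow_scale// mulNr mulrA mulrAC.
Qed.

Lemma solution_termE t r : solution_term k d v l c t r =
  S t r * (Gamma (b r) * mittag_leffler v%:C (b r) (X t)).
Proof. by rewrite /solution_term -/D -/(b r) -/(X t) /S; ring. Qed.

Lemma kstruve_term_scale t r y : t != 0 -> 0 < y ->
  S (y%:C * t) r = S t r * rpow y (b r - 1).
Proof.
by move=> t0 y0; rewrite /S exponentE cpow_scale// mulrA mulrAC.
Qed.

Lemma rpow_natM y u n : rpow y (u * n%:R) = rpow y u ^+ n.
Proof.
elim: n => [|n IH]; first by rewrite mulr0 rpow0 expr0.
by rewrite -addn1 natrD mulrDr mulr1 rpowD IH exprD.
Qed.

Lemma mittag_leffler_bound : exists2 K, 0 <= K & forall x r n,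
  cabs (Gamma (b r) * mittag_leffler_term v%:C (b r) x n) <=
  ml_majorant K v (cabs x) n.
Proof.
have [K K0 hK] := mittag_leffler_term_le a0_gt0 hv.
by exists K => // x r n; exact: hK.
Qed.

Lemma Gamma_mittag_leffler x r :
  cvg_csum (fun n => Gamma (b r) * mittag_leffler_term v%:C (b r) x n) /\
  csum (fun n => Gamma (b r) * mittag_leffler_term v%:C (b r) x n) =
  Gamma (b r) * mittag_leffler v%:C (b r) x.
Proof. exact: csumZ (cvg_csum_mittag_leffler _ hv (b_gt0 r)). Qed.

(** The factors [Gamma (b r) * mittag_leffler _ (b r) (X t)] are bounded by [2 * L] for all r at
    once, which leaves the k-Struve terms. *)
Lemma cvg_csum_solution_term t : t != 0 -> cvg_csum (solution_term k d v l c t).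
Proof.
move=> t0; have [K K0 hK] := mittag_leffler_bound.
have cK := cvg_ml_majorant (K := K) hv (cabs_ge0 (X t)).
pose L := limn (series (ml_majorant K v (cabs (X t)))).
have cS : cvgn (series ((2 * L) *: (fun r => cabs (S t r)))).
  exact: is_cvg_seriesZ (cvg_series_kstruve_term t0).
apply: cvg_csum_le cS => r; rewrite solution_termE cabsM mulrC.
apply: ler_wpM2r; first exact: cabs_ge0.
have [_ <-] := Gamma_mittag_leffler (X t) r.
by apply: cabs_csum_le cK => n; exact: hK.
Qed.

(** The dependence on y of the r-th term of the integrand: y^(b_r - 1) from the leading power, y^(v
    n) from X(y t)^n and (1 - y)^(v - 1) from the kernel form a Beta integrand. *)
Let V t r y := csum (fun n => Gamma (b r) * mittag_leffler_term v%:C (b r) (X t) n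
  * cbetaf (b r + v%:C * n%:R) v%:C y).

Lemma solution_term_scale t r y : t != 0 -> 0 < y < 1 ->
  rpow (1 - y) (v%:C - 1) * solution_term k d v l c (y%:C * t) r = S t r * V t r y.
Proof.
move=> t0 /andP[y0 y1].
rewrite solution_termE kstruve_term_scale// mittag_leffler_argument_scale//.
have [_ <-] := Gamma_mittag_leffler (X t * rpow y v%:C) r.
rewrite -(mulrA (S t r)) mulrCA; congr (_ * _).
rewrite mulrA -(csumZ _ _).2; last first.
  by have [] := Gamma_mittag_leffler (X t * rpow y v%:C) r.
congr csum; apply/funext => n; rewrite /mittag_leffler_term /cbetaf.
rewrite (addrAC (b r)) (rpowD y (b r - 1)) rpow_natM exprMn.
move: (Gamma (b r)) (Gamma (_ + _)) => G1 G2; ring.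
Qed.

Let g y := cabs (cbetaf a0%:C v%:C y).

Let integrable_g : mu.-integrable R01 (EFin \o g).
Proof.
apply: (@cintegrable_cabs _ _ _ (cbetaf a0%:C v%:C)); first exact: measurable_itv.
exact: cintegrable_cbetaf.
Qed.

Lemma cabs_cbetaf_le r n y : 0 < y < 1 ->
  cabs (cbetaf (b r + v%:C * n%:R) v%:C y) <= g y.
Proof.
move=> y01; rewrite /g !cabs_cbetaf//=; case/andP: y01 => y0 y1.
rewrite ler_wpM2r ?powR_ge0//; apply: ger_powR; first by rewrite y0 ltW.
rewrite lerD2r Re_add natC Re_mulR /=.
by apply: le_trans (Re_b r) _; rewrite lerDl mulr_ge0// ltW.
Qed.

(** [M] is chosen before [r] because the same bound must serve the later exchange of the integral
    with the series in r. *)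
Lemma fractional_integral_mittag_leffler t : exists2 M, 0 <= M & forall r,
  [/\ cintegrable R01 (V t r),
      forall y, 0 < y < 1 -> cabs (V t r y) <= M * g y &
      X t / Gamma v%:C * cintegral R01 (V t r) =
        Gamma (b r) * mittag_leffler v%:C (b r) (X t) - 1].
Proof.
have [K K0 hK] := mittag_leffler_bound.
have cK := cvg_ml_majorant (K := K) hv (cabs_ge0 (X t)).
have m0 n := ml_majorant_ge0 v n K0 (cabs_ge0 (X t)).
pose L := limn (series (ml_majorant K v (cabs (X t)))).
have L0 : 0 <= L.
  apply: le_trans (series_le_limn 0 m0 cK).
  by rewrite /series /= big_geq.
exists (2 * L); first by rewrite mulr_ge0.
move=> r; pose F n := Gamma (b r) * mittag_leffler_term v%:C (b r) (X t) n.
pose u n y := F n * cbetaf (b r + v%:C * n%:R) v%:C y.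
have ug n y : R01 y -> cabs (u n y) <= ml_majorant K v (cabs (X t)) n * g y.
  rewrite /= in_itv /= => y01; rewrite cabsM.
  by apply: ler_pM; rewrite ?cabs_ge0// ?hK// cabs_cbetaf_le.
have bn n : 0 < complex.Re (b r + v%:C * n%:R).
  by rewrite Re_add natC Re_mulR /= ltr_pwDl// mulr_ge0// ltW.
have m01 : measurable R01 by exact: measurable_itv.
have iu n : cintegrable R01 (cbetaf (b r + v%:C * n%:R) v%:C).
  exact: cintegrable_cbetaf.
have [| _ iV cI eI] := @cintegral_csum _ _ m01 u _ g _ m0 cK integrable_g ug.
  move=> n; apply: cmeasurableM; first exact: cmeasurable_cst.
  exact: cmeasurable_cbetaf.
split=> //.
  move=> y y01; have yR : R01 y by rewrite /= in_itv.
  have cg : cvgn (series (g y *: ml_majorant K v (cabs (X t)))).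
    exact: is_cvg_seriesZ.
  have -> : 2 * L * g y = 2 * limn (series (g y *: ml_majorant K v (cabs (X t)))).
    by rewrite lim_seriesZ// -mulrA (mulrC L).
  apply: cabs_csum_le cg => n; apply: le_trans (ug n y yR) _.
  by rewrite mulrC.
have Gv : Gamma v%:C != 0 by exact: Gamma_neq0.
rewrite eI -(csumZ _ cI).2.
have [cF <-] := Gamma_mittag_leffler (X t) r.
(* The term n = 0 is Gamma b / Gamma b and cancels the - 1; what remains is to match term n + 1 with
   the integral of term n. *)
rewrite (csum_S cF) {1}/mittag_leffler_term expr0 mulr0 add0r div1r.
rewrite mulfV ?Gamma_neq0// addrC addKr.
congr csum; apply/funext => n; rewrite cintegralZl//.
have vC : 0 < complex.Re (v%:C : R[i]) by [].
have := Gamma_Beta (bn n) vC; rewrite /Beta => GB.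
have Gn := Gamma_neq0 (bn n).
rewrite /F /mittag_leffler_term.
have e : v%:C * n.+1%:R + b r = b r + v%:C * n%:R + v%:C.
  by rewrite -natr1; ring.
have Gn1 : Gamma (b r + v%:C * n%:R + v%:C) != 0.
  by apply: Gamma_neq0; rewrite Re_add addr_gt0.
rewrite e (addrC (v%:C * n%:R)) exprS.
have -> : cintegral R01 (cbetaf (b r + v%:C * n%:R) v%:C) =
    Gamma (b r + v%:C * n%:R) * Gamma v%:C / Gamma (b r + v%:C * n%:R + v%:C).
  by rewrite GB [RHS]mulrC mulKf.
move: Gv Gn Gn1; move: (Gamma _) (Gamma _) => G1 G2.
move: (Gamma _) (Gamma (b r)) (X t ^+ n) => G3 G4 x G2_neq0 G1_neq0 G3_neq0.
by field; rewrite G1_neq0 G2_neq0 G3_neq0.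
Qed.

Lemma kinetic_solution_neq0 t (N0 : R[i]) : t != 0 ->
  let N := fun t : R[i] => N0 * csum (solution_term k d v l c t) in
  [/\ cvg_csum (S t), cintegrable R01 (riemann_liouville_integrand v%:C N t) &
    N t - N0 * csum (S t) = - (D * riemann_liouville v%:C N t)].
Proof.
move=> t0 N; have m01 : measurable R01 by exact: measurable_itv.
have cT := cvg_csum_solution_term t0.
have cS : cvg_csum (S t).
  exact: cvg_csum_le (fun r => lexx _) (cvg_series_kstruve_term t0).
have [M M0 hM] := fractional_integral_mittag_leffler t.
have iV r : cintegrable R01 (V t r) by have [] := hM r.
pose u r y := S t r * V t r y.
have iMg : mu.-integrable R01 (EFin \o (fun y => M * g y)).
  exact: integrable_EFinZ.
have [|| _ iU cI eI] := @cintegral_csum _ _ m01 u (fun r => cabs (S t r))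
  (fun y => M * g y) _ (fun r => cabs_ge0 _) (cvg_series_kstruve_term t0) iMg.
- move=> r; apply: cmeasurableM; first exact: cmeasurable_cst.
  exact: cintegrable_cmeasurable.
- move=> r y; rewrite /= in_itv /= => y01; rewrite cabsM.
  by rewrite ler_wpM2l ?cabs_ge0//; have [_ + _] := hM r; apply.
(* The kernel (t - y t)^(v-1) and the factor t of the parametrization combine to (1 - y)^(v-1) t^v;
   with - d^v the power t^v becomes [X t]. *)
have E : {in R01, (fun y => N0 * cpow t v%:C * csum (u ^~ y)) =1
    riemann_liouville_integrand v%:C N t}.
  move=> y; rewrite inE /= in_itv /= => y01; case/andP: (y01) => y0 y1.
  have yt0 : y%:C * t != 0 by rewrite mulf_neq0// real_complex_eq0 gt_eqF.
  have -> : u ^~ y = fun r =>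
      rpow (1 - y) (v%:C - 1) * solution_term k d v l c (y%:C * t) r.
    by apply/funext => r; rewrite solution_term_scale.
  rewrite (csumZ _ (cvg_csum_solution_term yt0)).2.
  rewrite /riemann_liouville_integrand /N.
  have -> : t - y%:C * t = (1 - y)%:C * t by rewrite rmorphB mulrBl mul1r.
  rewrite cpow_scale ?subr_gt0//.
  have -> : cpow t v%:C = cpow t (v%:C - 1) * t.
    by rewrite -{3}(cpow1 t0) -cpowD// subrK.
  ring.
split=> //.
  by apply: eq_cintegrable E _ => //; exact: cintegrableZl.
rewrite /riemann_liouville -(eq_cintegral E) cintegralZl// eI.
rewrite /N -mulrBr -(csumB cT cS).2.
have -> : - (D * ((Gamma v%:C)^-1 * (N0 * cpow t v%:C *
    csum (fun n => cintegral R01 (u n))))) =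
  N0 * (X t / Gamma v%:C * csum (fun n => cintegral R01 (u n))).
  by rewrite /X; move: (Gamma _) => G; ring.
congr (_ * _); rewrite -(csumZ _ cI).2; congr csum; apply/funext => r.
rewrite cintegralZl// mulrCA; have [_ _ ->] := hM r.
by rewrite solution_termE mulrBr mulr1.
Qed.

(** By the convention for powers of 0, both sides vanish unless 2 r + l / k + 1 = 0. In that case
    b_r = 1, all the powers are 1, and only the constant term of the Mittag-Leffler series
    survives. *)
Lemma solution_term0 r :
  solution_term k d v l c 0 r = kstruve_term k l c (D * cpow 0 v%:C) (v * carg 0) r.
Proof.
have x0 : D * cpow 0 v%:C = 0.
  by rewrite /cpow /cpow_arg eqxx (negbTE v_neq0) mulr0.
rewrite solution_termE /X x0 oppr0 /kstruve_term mul0r /S -mulrA -mulrA.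
congr (_ * _); rewrite /cpow_arg eqxx {2}/cpow /cpow_arg eqxx.
have bE : b r - 1 = v%:C * (2 * r%:R + l / k%:C + 1).
  by rewrite /b /solution_index; ring.
rewrite exponentE bE mulf_eq0 (negbTE v_neq0) /=.
case: eqP => [a_eq0|_]; last by rewrite mul0r mulr0.
have b1 : b r = 1 by apply/eqP; rewrite -subr_eq0 bE a_eq0 mulr0.
have [cE <-] := Gamma_mittag_leffler 0 r.
rewrite (csum_S cE) /mittag_leffler_term expr0 mulr0 add0r div1r.
rewrite mulfV ?Gamma_neq0//.
have -> : (fun n => Gamma (b r) * (0 ^+ n.+1 / Gamma (v%:C * n.+1%:R + b r))) =
    fun=> 0 :> R[i].
  by apply/funext => n; rewrite expr0n /= mul0r mulr0.
have -> : csum (fun=> 0 : R[i]) = 0.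
  have e : series (fun=> 0 : R) = fun=> 0.
    by apply/funext => n; rewrite /series /= big1.
  by rewrite /csum /= e lim_cst.
by rewrite addr0 mul1r mulr1 a_eq0 D2E rpowE// rpow0.
Qed.

(** Once Re b_r > 1 the exponent b_r - 1 is nonzero and its power of 0 vanishes, so the series has
    finitely many nonzero terms. *)
Lemma cvg_csum_solution_term0 : cvg_csum (solution_term k d v l c 0).
Proof.
have [m hm] : exists m : nat, 1 < complex.Re (b m).
  exists (Num.truncn ((1 - a0) / v)).+1.
  rewrite Re_solution_index -ltrBlDl -ltr_pdivrMr//.
  apply: lt_le_trans (truncnS_gt _) _; rewrite ler_peMl// ler1n//.
apply: (@cvg_csum_le _ _ (fun r => cabs (solution_term k d v l c 0 r))) => //.
apply: (@cvg_series_shift _ _ m); apply/cvg_ex; exists 0.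
rewrite (_ : series _ = fun=> 0); first exact: cvg_cst.
apply/funext => n; rewrite /series /= big1// => i _.
have bi : b (i + m) - 1 != 0.
  apply/eqP => /(congr1 (@complex.Re R)); rewrite Re_subr1 /=.
  apply/eqP; rewrite gt_eqF// subr_gt0 (lt_le_trans hm)//.
  by rewrite !Re_solution_index lerD2l ler_pM2r// ler_pM2l// ler_nat leq_addl.
rewrite solution_termE /S exponentE {2}/cpow /cpow_arg eqxx (negbTE bi).
by rewrite mulr0 mul0r cabs0.
Qed.

End KineticSolution.



(** * The solution for all complex t *)

Theorem theorem2 (R : realType) (k d v : R) (N0 c l : R[i])
    (hk : 0 < k) (hd : 0 < d) (hv : 0 < v)
    (hl : - (3 / 2) < complex.Re l)
    (hint : - 1 < v * (complex.Re l / k + 1)) :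
  (forall (t : R[i]) (r : nat),
     cvg_csum (mittag_leffler_term v%:C (solution_index k v l r)
                 (- ((d `^ v)%:C * cpow t v%:C)))) /\
  (forall t : R[i], cvg_csum (solution_term k d v l c t)) /\
  kinetic_solution k d v N0 l c
    (fun t : R[i] => N0 * csum (solution_term k d v l c t)).
Proof.
have cT t : cvg_csum (solution_term k d v l c t).
  have [->|t0] := eqVneq t 0; first exact: cvg_csum_solution_term0.
  exact: cvg_csum_solution_term.
split; [|split=> //].
  move=> t r; apply: cvg_csum_mittag_leffler => //.
  rewrite Re_solution_index; apply: ltr_wpDr; first by rewrite !mulr_ge0// ltW.
  by rewrite -ltrBlDr sub0r.
move=> t x; have [t0|t0] := eqVneq t 0; last first.
  have [cS iN e] := kinetic_solution_neq0 c hk hd hv hint N0 t0.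
  have SE : kstruve_term k l c x (v * carg t) =
      fun r => kstruve_coef k l c r *
        cpow ((d `^ v)%:C / 2) (2 * r%:R + l / k%:C + 1) *
        cpow t (2 * v%:C * r%:R + l / k%:C * v%:C + v%:C).
    by apply/funext => r; rewrite -kstruve_termE.
  by rewrite /kstruve SE; split.
have SE : kstruve_term k l c x (v * carg t) = solution_term k d v l c t.
  by apply/funext => r; rewrite t0 (solution_term0 _ hd hv hint) /x t0.
(* At t = 0 the factor t of the parametrization kills the integrand, and the equation reduces to the
   termwise equality [SE]. *)
have I0 N : riemann_liouville_integrand v%:C N t = fun=> 0.
  by apply/funext => y; rewrite /riemann_liouville_integrand t0 mulr0.
rewrite /kstruve SE; split => //.
  by rewrite I0; split; exact: integrable0.
rewrite subrr /riemann_liouville I0 /cintegral /=.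
by rewrite /Rintegral integral0 /= !mulr0 oppr0.
Qed.
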